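(* Assume that the pair $\boldsymbol\Lambda, l$ is separating. Then the linear map $\tau: A_D^*\to \mathrm{Sing}\,M_{\boldsymbol\Lambda}[\Lambda^{(\infty)}]$ has image $\mathrm{Sing}\,M_{\boldsymbol\Lambda}[\Lambda^{(\infty)}]$ and zero kernel.
   Context: Setting. $\mathfrak{gl}_2$ is the Lie algebra of complex $2\times2$ matrices with standard generators $e_{ab}$, $a,b=1,2$; $\epsilon_1,\epsilon_2$ is the standard basis of the dual of the diagonal Cartan subalgebra and $\alpha=\epsilon_1-\epsilon_2$. Fix distinct $z_1,\dots,z_n\in\mathbb C$, numbers $m_1,\dots,m_n\in\mathbb C$ and an integer $l\ge 0$. Put $\Lambda^{(s)}=m_s\epsilon_1$, $\boldsymbol\Lambda=(\Lambda^{(1)},\dots,\Lambda^{(n)})$, $\Lambda^{(\infty)}=\sum_{s=1}^n\Lambda^{(s)}-l\alpha$. The pair $\boldsymbol\Lambda,l$ is separating if $\sum_{s=1}^n m_s-2l+1+i\ne0$ for all $i=1,\dots,l$. $M_{\boldsymbol\Lambda}=M_{\Lambda^{(1)}}\otimes\cdots\otimes M_{\Lambda^{(n)}}$ is the tensor product of Verma $\mathfrak{gl}_2$-modules; $M_{\Lambda^{(s)}}$ has generating vector $v_{\Lambda^{(s)}}$ with $e_{12}v_{\Lambda^{(s)}}=0$, $e_{11}v_{\Lambda^{(s)}}=m_sv_{\Lambda^{(s)}}$, $e_{22}v_{\Lambda^{(s)}}=0$ and basis $e_{21}^jv_{\Lambda^{(s)}}$, $j\ge0$. $M_{\boldsymbol\Lambda}[\Lambda^{(\infty)}]$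 is the subspace of vectors of weight $\Lambda^{(\infty)}$ and $\mathrm{Sing}\,M_{\boldsymbol\Lambda}[\Lambda^{(\infty)}]=\{v\in M_{\boldsymbol\Lambda}: e_{12}v=0,\ e_{22}v=lv\}$. Algebra $A_D$. Let $\boldsymbol a=(a_1,\dots,a_l)$, $\boldsymbol h=(h_1,\dots,h_n)$ be variables, $p(x,\boldsymbol a)=x^l+a_1x^{l-1}+\dots+a_l$, $$\mathcal D_{\boldsymbol h}=\Big(\prod_{s=1}^n(x-z_s)\Big)\Big(\frac{d^2}{dx^2}-\sum_{s=1}^n\frac{m_s}{x-z_s}\frac d{dx}+\sum_{s=1}^n\frac{h_s}{x-z_s}\Big),$$ $q_{-1}(\boldsymbol h)=\sum_s h_s$, $q_0(\boldsymbol h)=\sum_s z_sh_s-l(\sum_s m_s+1-l)$. For $1\le i\le l+n-2$ let $q_i(\boldsymbol a,\boldsymbol h)$ be the coefficient of $x^{l+n-2-i}$ in $\mathcal D_{\boldsymbol h}(p(x,\boldsymbol a))$ (when $q_{-1}=q_0=0$ these are all the coefficients of this polynomial in $x$). Let $I_D\subset\mathbb C[\boldsymbol a,\boldsymbol h]$ be the ideal generated by $q_{-1},q_0,q_1,\dots,q_{l+n-2}$ and $A_D=\mathbb C[\boldsymbol a,\boldsymbol h]/I_D$. For a separating pair $A_D$ is finite-dimensional; $A_D^*$ is the dual vector space. Map $\tau$. Identify $M_{\boldsymbol\Lambda}$ with $\mathbb C[x^{(1)},\dots,x^{(n)}]$ via $e_{21}^{j_1}v_{\Lambda^{(1)}}\otimes\cdots\otimes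 e_{21}^{j_n}v_{\Lambda^{(n)}}\mapsto (x^{(1)})^{j_1}\cdots(x^{(n)})^{j_n}$. The universal weight function is $$\omega=\prod_{j=1}^l\Big(\prod_{i=1}^n(t_j-z_i)\sum_{s=1}^n\frac{x^{(s)}}{t_j-z_s}\Big);$$ being a symmetric polynomial in $t_1,\dots,t_l$, it is viewed as a polynomial in $x^{(1)},\dots,x^{(n)}$ and $\boldsymbol a$ through $\prod_{i=1}^l(x-t_i)=p(x,\boldsymbol a)$, i.e. as an element of $M_{\boldsymbol\Lambda}[\Lambda^{(\infty)}]\otimes\mathbb C[\boldsymbol a]$. Let $\omega_D$ be its projection to $M_{\boldsymbol\Lambda}\otimes A_D$; in fact $\omega_D\in \mathrm{Sing}\,M_{\boldsymbol\Lambda}[\Lambda^{(\infty)}]\otimes A_D$. Writing $\omega_D=\sum_i v_i\otimes f_i$ with $\{f_i\}$ a basis of $A_D$, the map $\tau$ is $\tau(g)=g(\omega_D)=\sum_i g(f_i)v_i$ for $g\in A_D^*$. *)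

(* Defs.v *)
From HB Require Import structures.
From mathcomp Require Import all_boot all_order all_algebra.
From mathcomp Require Import perm ring_quotient ring finmap.
From mathcomp Require Import boolp.
From mathcomp.multinomials Require Import mpoly.

Set Implicit Arguments.
Unset Strict Implicit.
Unset Printing Implicit Defensive.

Import GRing.Theory.
Local Open Scope ring_scope.
Local Open Scope quotient_scope.

(* The indices 1 and 2 of the generators e_ab of gl_2. *)
Notation idx1 := (ord0 : 'I_2).
Notation idx2 := (ord_max : 'I_2).

(* With a = (a_0, ..., a_{l-1}) standing for (a_1, ..., a_l):
   x^l + a_1 x^(l-1) + ... + a_l. *)
Definition pmonic (R : nzRingType) (l : nat) (a : 'I_l -> R) : {poly R} :=
  'X^l + \sum_(i < l) (a i)%:P * 'X^(l - i.+1).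

Section Verma.
Variable F : fieldType.

(* The Verma module of highest weight m * eps_1 on {poly F}, where 'X^j stands
   for e_21^j v.  Lemmas verma_bracket, verma_hw and verma_basis below pin the
   action down. *)
Definition verma (m : F) (a b : 'I_2) (p : {poly F}) : {poly F} :=
  match val a, val b with
  | 0, 0 => m *: p - 'X * p^`()
  | 0, _ => m *: p^`() - 'X * p^`()^`()
  | _, 0 => 'X * p
  | _, _ => 'X * p^`()
  end.

Lemma verma_linear m a b : linear (verma m a b).
Proof.
move=> c p q; rewrite /verma.
by case: a b => [[|?] ?] [[|?] ?] /=;
  rewrite -?mul_polyC ?(derivE, mul0r, add0r, addr0); ring.
Qed.

(* [e_ab, e_cd] = delta_bc e_ad - delta_da e_cb *)
Lemma verma_bracket m a b c d p :
  verma m a b (verma m c d p) - verma m c d (verma m a b p) =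
  verma m a d p *+ (b == c) - verma m c b p *+ (d == a).
Proof.
rewrite /verma.
by case: a b c d => [[|[|//]] ?] [[|[|//]] ?] [[|[|//]] ?] [[|[|//]] ?] /=;
  rewrite -?mul_polyC ?(derivE, mul0r, add0r, addr0) /= ?(mulr0n, mulr1n); ring.
Qed.

Lemma verma_hw m :
  [/\ verma m idx1 idx2 1 = 0, verma m idx1 idx1 1 = m *: 1
    & verma m idx2 idx2 1 = 0].
Proof. by rewrite /verma /= !derivE !linear0 !(mulr0, subr0, scaler0). Qed.

Lemma verma_basis m j : iter j (verma m idx2 idx1) 1 = 'X^j.
Proof. by elim: j => [|j IHj]; rewrite ?expr0 //= IHj /verma /= exprS. Qed.

End Verma.

Section TensorProduct.
Variables (F : fieldType) (n : nat).

(* In {mpoly F[n]}, 'X_[k] stands for the tensor product over s of the vectors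
   e_21^(k s) v_s.  on_factor s f is the endomorphism f of the s-th factor
   tensored with the identity of the other factors. *)
Definition on_factor (s : 'I_n) (f : {poly F} -> {poly F}) (p : {mpoly F[n]}) :
    {mpoly F[n]} :=
  \sum_(k <- msupp p) p@_k *:
    ((map_poly (@mpolyC n F) (f 'X^(k s))).['X_s]
       * \prod_(r < n | r != s) 'X_r ^+ k r).

Lemma on_factorX s f (k : 'X_{1..n}) :
  on_factor s f 'X_[k] =
  (map_poly (@mpolyC n F) (f 'X^(k s))).['X_s]
    * \prod_(r < n | r != s) 'X_r ^+ k r.
Proof. by rewrite /on_factor msuppX big_seq1 mcoeffX eqxx scale1r. Qed.

Variable m : 'I_n -> F.

Definition gl2_act (a b : 'I_2) (v : {mpoly F[n]}) : {mpoly F[n]} :=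
  \sum_(s < n) on_factor s (verma (m s) a b) v.

Definition is_sing (l : nat) (v : {mpoly F[n]}) : Prop :=
  gl2_act idx1 idx2 v = 0 /\ gl2_act idx2 idx2 v = l%:R *: v.

Definition separating (l : nat) : Prop :=
  forall i : nat, (1 <= i <= l)%N ->
    \sum_(s < n) m s - (2 * l)%:R + 1 + i%:R != 0.

End TensorProduct.

Section Algebra.
Variables (F : fieldType) (n l : nat) (z m : 'I_n -> F).

(* F[a, h] *)
Notation Fah := {mpoly F[l + n]}.

Definition avar (i : 'I_l) : Fah := 'X_(lshift n i).
Definition hvar (s : 'I_n) : Fah := 'X_(rshift l s).

Definition pxa : {poly Fah} := pmonic avar.

Definition xz (s : 'I_n) : {poly Fah} := 'X - ((z s)%:MP)%:P.

(* D_h with the product over s of (x - z_s) multiplied out, so that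
   (x - z_s)^-1 becomes the product over r <> s of (x - z_r). *)
Definition Dh (p : {poly Fah}) : {poly Fah} :=
  (\prod_(s < n) xz s) * p^`()^`()
  - (\sum_(s < n) ((m s)%:MP)%:P * \prod_(r < n | r != s) xz r) * p^`()
  + (\sum_(s < n) (hvar s)%:P * \prod_(r < n | r != s) xz r) * p.

Definition q_m1 : Fah := \sum_(s < n) hvar s.

Definition q_0 : Fah :=
  \sum_(s < n) z s *: hvar s
  - (l%:R * (\sum_(s < n) m s + 1 - l%:R))%:MP.

Definition q_ (i : nat) : Fah := (Dh pxa)`_(l + n - 2 - i).

(* q_{-1}, q_0, q_1, ..., q_{l+n-2} *)
Definition ID_gens : seq Fah :=
  q_m1 :: q_0 :: [seq q_ i | i <- iota 1 (l + n - 2)].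

Definition ID (f : Fah) : bool :=
  `[< exists c : 'I_(size ID_gens) -> Fah,
        f = \sum_(i < size ID_gens) c i * ID_gens`_i >].

Lemma ID_mulB (c f g : Fah) : ID f -> ID g -> ID (c * f - g).
Proof.
move=> /asboolP [cf ->] /asboolP [cg ->]; apply/asboolP.
exists (fun i => c * cf i - cg i); rewrite mulr_sumr -sumrB.
by apply: eq_bigr => i _; rewrite mulrBl mulrA.
Qed.

Lemma ID0 : ID 0.
Proof.
by apply/asboolP; exists (fun=> 0); rewrite big1 // => i _; rewrite mul0r.
Qed.

Lemma ID_zmod_closed : zmod_closed ID.
Proof.
by split=> [|f g If Ig]; [exact: ID0|rewrite -[f]mul1r; exact: ID_mulB].
Qed.

HB.instance Definition _ := GRing.isZmodClosed.Build Fah ID ID_zmod_closed.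

(* Only the vector space structure of F[a, h] / I_D is set up, since A_D enters
   through its linear dual; it may be the zero ring. *)
Definition ID_closed := GRing.ZmodClosed.clone Fah ID _.
Definition AD : Type := {ideal_quot ID_closed}.
HB.instance Definition _ := GRing.Zmodule.on AD.

Definition piAD (f : Fah) : AD := \pi_({ideal_quot ID_closed}) f.

Lemma piAD_eq (f g : Fah) : piAD f = piAD g <-> ID (f - g).
Proof.
by split=> [/eqP|H]; [|apply/eqP]; rewrite /piAD -Quotient.idealrBE.
Qed.

Lemma piADB (f g : Fah) : piAD (f - g) = piAD f - piAD g.
Proof. exact: (raddfB (\pi_({ideal_quot ID_closed}))). Qed.

Definition scaleAD (c : F) (x : AD) : AD :=
  piAD (c *: repr (x : {ideal_quot ID_closed})).

Lemma scaleAD_pi c f : scaleAD c (piAD f) = piAD (c *: f).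
Proof.
apply/piAD_eq; rewrite -scalerBr -mul_mpolyC -[_ * _]subr0.
apply: ID_mulB ID0; apply/piAD_eq; exact: reprK.
Qed.

Lemma piAD_repr (x : AD) : piAD (repr (x : {ideal_quot ID_closed})) = x.
Proof. exact: reprK. Qed.

Lemma piADD (f g : Fah) : piAD (f + g) = piAD f + piAD g.
Proof. exact: (raddfD (\pi_({ideal_quot ID_closed}))). Qed.

Lemma scaleADA a b (x : AD) : scaleAD a (scaleAD b x) = scaleAD (a * b) x.
Proof. by rewrite -[x]piAD_repr !scaleAD_pi scalerA. Qed.

Lemma scaleAD1 : left_id 1 scaleAD.
Proof. by move=> x; rewrite -[x]piAD_repr scaleAD_pi scale1r. Qed.

Lemma scaleADDr : right_distributive scaleAD +%R.
Proof.
move=> c x y; rewrite -[x]piAD_repr -[y]piAD_repr -piADD !scaleAD_pi -piADD.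
by rewrite scalerDr.
Qed.

Lemma scaleADDl (x : AD) : {morph scaleAD^~ x : a b / a + b}.
Proof. by move=> a b; rewrite -[x]piAD_repr !scaleAD_pi -piADD scalerDl. Qed.

HB.instance Definition _ :=
  GRing.Zmodule_isLmodule.Build F AD scaleADA scaleAD1 scaleADDr scaleADDl.

Lemma piAD_linear : linear piAD.
Proof. by move=> c f g; rewrite piADD -scaleAD_pi. Qed.

End Algebra.

Section WeightFunction.
Variables (F : fieldType) (n l : nat) (z : 'I_n -> F).

(* The universal weight function in the variables t, as a polynomial in the
   x^(s) with coefficients in F[t]; (t_j - z_s)^-1 is cancelled against the
   product over i of (t_j - z_i). *)
Definition omega_t : {mpoly {mpoly F[l]}[n]} :=
  \prod_(j < l) \sum_(s < n)
    (\prod_(i < n | i != s) ('X_j - (z i)%:MP)) *: 'X_s.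

(* The coefficients of prod_i (x - t_i), see pmonic_a_of_t. *)
Definition a_of_t : l.-tuple {mpoly F[l]} :=
  [tuple (-1) ^+ i.+1 *: mesym l F i.+1 | i < l].

Lemma pmonic_a_of_t :
  pmonic (tnth a_of_t) = \prod_(i < l) ('X - ('X_i)%:P).
Proof.
have [f fX fs] : exists2 f : {rmorphism {mpoly int[l]} -> {mpoly F[l]}},
    forall i : 'I_l, f 'X_i = 'X_i & forall k, f (mesym l int k) = mesym l F k.
  exists (@map_mpoly l int F intr) => [i|k]; first exact: map_mpolyX.
  rewrite /mesym raddf_sum; apply: eq_bigr => h _.
  by rewrite /= rmorph_prod; apply: eq_bigr => i _; exact: map_mpolyX.
have := congr1 (map_poly f) (Viete l).
rewrite rmorph_prod raddf_sum /=.
under eq_bigr do rewrite rmorphB /= map_polyX map_polyC /= fX.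
move=> ->; rewrite big_ord_recl /pmonic; congr (_ + _).
  by rewrite expr0 scale1r mesym0E scale1r subn0 map_polyXn.
apply: eq_bigr => i _; rewrite tnth_mktuple lift0 scalerA -mul_polyC.
rewrite rmorphM /= map_polyC map_polyXn /=.
congr (_%:P * _); rewrite rmorphM /= fs rmorphXn /= rmorphN1.
rewrite -[in LHS]signr_odd -[in RHS]signr_odd; case: odd.
  by rewrite !expr1 scaleN1r mulN1r.
by rewrite !expr0 scale1r mul1r.
Qed.

(* symf q expresses the symmetric polynomial q in terms of the elementary
   symmetric polynomials, e_i(t) = (-1)^i a_i. *)
Definition sym_to_a (q : {mpoly F[l]}) : {mpoly F[l]} :=
  symf q \mPo [tuple (-1) ^+ i.+1 *: 'X_i | i < l].

Definition omega_a : {mpoly {mpoly F[l]}[n]} :=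
  \sum_(k <- msupp omega_t) sym_to_a omega_t@_k *: 'X_[k].

Lemma omega_t_sym (k : 'X_{1..n}) : omega_t@_k \is symmetric.
Proof.
apply/issymP => s; rewrite -mcoeff_map_mpoly; congr (_@_k).
rewrite /omega_t rmorph_prod /= [RHS](reindex_inj (@perm_inj _ s)) /=.
apply: eq_bigr => j _; rewrite raddf_sum; apply: eq_bigr => i _ /=.
rewrite map_mpolyZ map_mpolyX rmorph_prod; congr (_ *: _).
by apply: eq_bigr => r _; rewrite raddfB /= /msym mmapX mmap1U mmapC.
Qed.

Lemma sym_to_aK (q : {mpoly F[l]}) :
  q \is symmetric -> sym_to_a q \mPo a_of_t = q.
Proof.
move=> q_sym; rewrite [RHS]symfP // /sym_to_a.
set p := symf q.
rewrite [p \mPo _]comp_mpolyE [RHS]comp_mpolyE raddf_sum /=.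
apply: eq_bigr => k _; rewrite comp_mpolyZ rmorph_prod; congr (_ *: _).
apply: eq_bigr => i _; rewrite rmorphXn /= !tnth_mktuple comp_mpolyZ.
rewrite comp_mpolyXU -tnth_nth tnth_mktuple scalerA -exprD addnn.
by rewrite -signr_odd odd_double scale1r.
Qed.

(* omega_a is omega_t written in the coefficients a of prod_i (x - t_i). *)
Lemma omega_aP (k : 'X_{1..n}) : omega_a@_k \mPo a_of_t = omega_t@_k.
Proof.
rewrite /omega_a raddf_sum /=.
under eq_bigr do rewrite mcoeffZ mcoeffX.
have [kS|kS] := boolP (k \in msupp omega_t).
  rewrite (bigD1_seq k) ?msupp_uniq //= eqxx mulr1 big1 ?addr0 => [|j /negPf ->].
    exact/sym_to_aK/omega_t_sym.
  by rewrite mulr0.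
rewrite big1_seq => [|j /= jS]; first by rewrite comp_mpoly0 memN_msupp_eq0.
by case: eqP jS kS => [->|_]; rewrite ?mulr0 // => ->.
Qed.

End WeightFunction.

Section Tau.
Variables (F : fieldType) (n l : nat) (z m : 'I_n -> F).

Notation A_D := (AD l z m).

Definition a_to_AD (q : {mpoly F[l]}) : A_D :=
  piAD z m (q \mPo [tuple avar F n i | i < l]).

(* The tensor product of {mpoly F[n]} with a vector space A, as the space of
   finitely supported families of elements of A indexed by the monomial basis. *)
Definition M_tensor (A : lmodType F) := {fsfun 'X_{1..n} -> A with 0}.

Definition omega_D : M_tensor A_D :=
  [fsfun k in seq_fset tt (msupp (omega_a l z)) => a_to_AD (omega_a l z)@_k].

Lemma omega_DE (k : 'X_{1..n}) : omega_D k = a_to_AD (omega_a l z)@_k.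
Proof.
rewrite fsfun_fun seq_fsetE.
case: ifPn => // /memN_msupp_eq0 ->.
by rewrite /a_to_AD comp_mpoly0 /piAD raddf0.
Qed.

(* contract g w is g(w); by contractE, it is sum_i g(f_i) v_i whenever w is the
   sum of the v_i (x) f_i. *)
Definition contract (A : lmodType F) (g : {scalar A}) (w : M_tensor A) :
    {mpoly F[n]} :=
  \sum_(k <- finsupp w) g (w k) *: 'X_[k].

Lemma contractE (A : lmodType F) (g : {scalar A}) (w : M_tensor A)
    (I : finType) (v : I -> {mpoly F[n]}) (f : I -> A) :
  (forall k, w k = \sum_i (v i)@_k *: f i) ->
  contract g w = \sum_i g (f i) *: v i.
Proof.
move=> wE; rewrite /contract.
pose K := undup (finsupp w ++ flatten [seq msupp (v i) | i <- enum I]).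
have memK k i : k \in msupp (v i) -> k \in K.
  move=> kv; rewrite mem_undup mem_cat; apply/orP; right.
  by apply/flattenP; exists (msupp (v i)) => //; apply/mapP; exists i; rewrite ?mem_enum.
transitivity (\sum_(k <- K) g (w k) *: 'X_[F, k]).
  apply: esym; rewrite (bigID (mem (finsupp w))) /= [X in _ + X]big1 ?addr0.
    rewrite -big_filter; apply: perm_big; apply: uniq_perm.
    - exact/filter_uniq/undup_uniq.
    - exact: fset_uniq.
    by move=> k; rewrite mem_filter mem_undup mem_cat; case: (k \in finsupp w).
  by move=> k kw; rewrite fsfun_dflt // raddf0 scale0r.
transitivity (\sum_(k <- K) \sum_i (g (f i) * (v i)@_k) *: 'X_[F, k]).
  apply: eq_bigr => k _; rewrite wE raddf_sum scaler_suml.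
  by apply: eq_bigr => i _; rewrite /= scalarZ mulrC.
rewrite exchange_big; apply: eq_bigr => i _ /=.
under eq_bigr do rewrite -scalerA.
rewrite -scaler_sumr; congr (_ *: _).
apply/mpolyP => k; rewrite raddf_sum /=.
under eq_bigr do rewrite mcoeffZ mcoeffX.
have [kK|kK] := boolP (k \in K).
  rewrite (bigD1_seq k) ?undup_uniq //= eqxx mulr1 big1 ?addr0 // => j /negPf ->.
  by rewrite mulr0.
rewrite big1_seq => [|j /= jK].
  by rewrite memN_msupp_eq0 //; apply: contra kK; apply: memK.
by case: eqP jK kK => [->|_]; rewrite ?mulr0 // => ->.
Qed.

Definition tau (g : {scalar A_D}) : {mpoly F[n]} := contract g omega_D.

End Tau.

(* Main.v *)
From HB Require Import structures.
Require Import Defs.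
From mathcomp Require Import all_boot all_order all_algebra.
From mathcomp Require Import reals complex.
From mathcomp Require Import ring_quotient ring zify finmap boolp.
From mathcomp.multinomials Require Import mpoly.

Set Implicit Arguments.
Unset Strict Implicit.
Unset Printing Implicit Defensive.

Import GRing.Theory.
Local Open Scope ring_scope.

(* Separation of variables. Write A = \prod_s (t - z_s), A_s = A / (t - z_s),
   B = \sum_s m_s A_s and let y_1, ..., y_{n-1} be the roots of
   \sum_s x_s A_s(t). In the coordinates y the weight function is
   \prod_k p(y_k), and the Gaudin Hamiltonians H_s satisfy, for every k,
     A(y_k) d_k^2 - B(y_k) d_k + \sum_s A_s(y_k) H_s = 0.
   A polynomial of degree < n - 1 vanishing at all the y_k is 0, so these
   equations determine the H_s; hence the H_s commute, and
   H_s (tau g) = tau (h_s g) because D_h p = 0 in A_D. The singular vectors are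
   the vectors of degree l on which \sum_s z_s H_s acts by l (\sum_s m_s + 1 - l).
   For a separating pair the equation D_h p = 0 expresses the coefficients of p
   through the h_s. If tau g = 0, then tau (f g) = 0 for all f in A_D, and the
   coefficient of \prod_k y_k^l, which is g(f), is 0. Conversely A_D acts on the
   singular vectors through the H_s, because a singular vector is killed by the
   ordinary differential operator above in each y_k separately; a singular
   vector v is the image of the functional sending f to the coefficient of
   \prod_k y_k^l in f v. *)

(** The coordinates y forget the scale of x: [sep] sends \sum_s x_s to a constant, so it is
    injective only on forms of one fixed degree. This is enough, since all vectors concerned have
    degree l. The separating condition is the solvability of a triangular system. Once \sum_s h_s =
    0 and \sum_s z_s h_s is fixed, the coefficient of t^(d+n) in t^2 D_h p involves only the
    coefficients of p from t^d upwards, and that of t^d enters with the factor (l - d)(\sum_s m_s -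
    2l + 1 + (l - d)). At d = l the factor is 0, so the leading coefficient 1 is consistent; at d <
    l it is nonzero by the hypothesis for i = l - d. The coefficients in y_k of a singular vector
    obey the same recursion with H_s in place of h_s, so the recursion is stated once, for families
    in any vector space. Multiplication in A_D is replaced by multiplication of functionals on
    F[a, h] that vanish on I_D. With n = N + 1 there are N separated coordinates; n = 0 is treated
    directly. *)

Section Lagrange.
Variables (F : fieldType) (n : nat) (z : 'I_n -> F).

Definition node_poly : {poly F} := \prod_(s < n) ('X - (z s)%:P).
Definition conode_poly (s : 'I_n) : {poly F} :=
  \prod_(r < n | r != s) ('X - (z r)%:P).

Lemma node_polyE s : node_poly = ('X - (z s)%:P) * conode_poly s.
Proof. by rewrite /node_poly (bigD1 s). Qed.

Lemma monic_node : node_poly \is monic.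
Proof. exact: monic_prod_XsubC. Qed.

Lemma size_node : size node_poly = n.+1.
Proof. by rewrite size_prod_XsubC -[index_enum _]enumT size_enum_ord. Qed.

Lemma monic_conode s : conode_poly s \is monic.
Proof. by apply: monic_prod => r _; exact: monicXsubC. Qed.

Lemma size_conode s : size (conode_poly s) = n.
Proof.
have /eqP := size_node; rewrite (node_polyE s) size_monicM ?monicXsubC //.
  by rewrite size_XsubC /= eqSS => /eqP.
by rewrite monic_neq0 ?monic_conode.
Qed.

Hypothesis z_inj : injective z.

Lemma conode_poly_root s r : r != s -> (conode_poly s).[z r] = 0.
Proof.
by move=> rs; rewrite horner_prod (bigD1 r) //= hornerXsubC subrr mul0r.
Qed.

Lemma conode_poly_neq0 s : (conode_poly s).[z s] != 0.
Proof.
rewrite horner_prod prodf_seq_neq0; apply/allP => r _; apply/implyP => rs.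
by rewrite hornerXsubC subr_eq0 (inj_eq z_inj) eq_sym.
Qed.

Definition gap (r s : 'I_n) : F := (z r - z s)^-1.

Lemma gapC r s : gap s r = - gap r s.
Proof. by rewrite /gap -opprB invrN. Qed.

Lemma gapK r s : r != s -> gap r s * (z r - z s) = 1.
Proof. by move=> rs; rewrite mulVf // subr_eq0 (inj_eq z_inj). Qed.

End Lagrange.

(** * The algebraic identity behind separation of variables *)

Section SeparationIdentity.
Variables (F : fieldType) (n : nat) (z m : 'I_n -> F) (T : comAlgType F).
Hypothesis z_inj : injective z.

Definition mass_poly : {poly F} := \sum_(s < n) m s *: conode_poly z s.

(* On the hyperplane \sum_s x_s A_s(y) = 0, parametrised by x_s = (y - z_s) w_s
   with \sum_s w_s = 0, the Gaudin Hamiltonians become a differential operator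
   in y alone; d1 and d2 stand for the partial derivatives in the x_s. *)
Lemma separation_identity (y : T) (w d1 : 'I_n -> T) (d2 : 'I_n -> 'I_n -> T)
    (x := fun s => (y - (z s)%:A) * w s)
    (kappa := fun r s => x r * x s * d2 r s - x r * x s * d2 s s
                         - (m r)%:A * x s * d1 s + (m s)%:A * x r * d1 s) :
  \sum_s w s = 0 ->
  horner_alg y (node_poly z) * (\sum_r \sum_s w r * w s * d2 r s)
  - horner_alg y mass_poly * (\sum_s w s * d1 s)
  + \sum_s horner_alg y (conode_poly z s) *
       (\sum_r (gap z r s)%:A * (kappa r s + kappa s r)) = 0.
Proof.
move=> w0.
set A := horner_alg y (node_poly z).
pose a s := horner_alg y (conode_poly z s).
have Aa s : A = (y - (z s)%:A) * a s.
  by rewrite /A (node_polyE z s) rmorphM rmorphB /= horner_algX horner_algC.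
(* Symmetrising over the pair r, s cancels the pole: with A_s = (y - z_r) b and A_r = (y - z_s) b,
   the factor [gap z r s] times A_s - A_r is - b. *)
have pairE r s : (gap z r s)%:A * (a s - a r) * kappa r s =
   - (A * w r * w s * (d2 r s - d2 s s) - (m r)%:A * a r * w s * d1 s
      + (m s)%:A * a s * w r * d1 s).
  have [<-|rs] := eqVneq r s.
    by rewrite !subrr !(mulr0, mul0r, sub0r); ring.
  pose b := horner_alg y (\prod_(q < n | (q != s) && (q != r)) ('X - (z q)%:P)).
  have as_ : a s = (y - (z r)%:A) * b.
    rewrite /a /conode_poly (bigD1 r) //= rmorphM rmorphB /=.
    by rewrite horner_algX horner_algC.
  have ar : a r = (y - (z s)%:A) * b.
    rewrite /a /conode_poly (bigD1 s) 1?eq_sym //= rmorphM rmorphB /=.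
    rewrite horner_algX horner_algC; congr (_ * _).
    by rewrite /b; congr horner_alg; apply: eq_bigl => q; rewrite andbC.
  have -> : (gap z r s)%:A * (a s - a r) = - b.
    have gE : (gap z r s)%:A * ((z s)%:A - (z r)%:A) = -1 :> T.
      rewrite -scalerBl -scalerAl mul1r scalerA -opprB mulrN gapK //.
      by rewrite scaleN1r.
    by rewrite as_ ar -[- b]mulN1r -gE; ring.
  rewrite (Aa s) as_ ar /kappa /x; ring.
have -> : \sum_s a s * (\sum_r (gap z r s)%:A * (kappa r s + kappa s r)) =
          \sum_r \sum_s (gap z r s)%:A * (a s - a r) * kappa r s.
  under eq_bigr do rewrite mulr_sumr.
  under [X in X = _]eq_bigr => s _ do
    under eq_bigr => r _ do rewrite mulrDr mulrDr.
  under [X in X = _]eq_bigr do rewrite big_split /=.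
  rewrite big_split /= [X in X + _]exchange_big /= -big_split /=.
  apply: eq_bigr => r _; rewrite -big_split /=; apply: eq_bigr => s _.
  by rewrite gapC scaleNr; ring.
have -> : horner_alg y mass_poly * (\sum_s w s * d1 s) =
          \sum_r \sum_s (m r)%:A * a r * w s * d1 s.
  rewrite /mass_poly raddf_sum /= mulr_suml; apply: eq_bigr => r _.
  rewrite linearZ /= -/(a r) -mulr_algl mulr_sumr.
  by apply: eq_bigr => s _; rewrite !mulrA.
have -> : A * (\sum_r \sum_s w r * w s * d2 r s) =
          \sum_r \sum_s A * (w r * w s * d2 r s).
  by rewrite mulr_sumr; apply: eq_bigr => r _; rewrite mulr_sumr.
rewrite -sumrB -big_split /=.
(* The mixed second derivatives cancel, and what is left depends on r only through w_r, so that
   \sum_r w_r = 0 finishes the proof. *)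
transitivity (\sum_r w r * (\sum_s (A * w s * d2 s s - (m s)%:A * a s * d1 s))).
  apply: eq_bigr => r _; rewrite -sumrB -big_split /= mulr_sumr.
  by apply: eq_bigr => s _; rewrite pairE; ring.
by rewrite -mulr_suml w0 mul0r.
Qed.

End SeparationIdentity.

(** * Chain rule, Euler operator and homogeneity *)

Section MpolyCalculus.
Variables (F : comNzRingType) (n : nat).
Implicit Types (f g : {mpoly F[n]}) (i s : 'I_n).

Lemma mpoly_mulX_ind (P : {mpoly F[n]} -> Prop) :
  (forall c, P c%:MP) -> (forall f g, P f -> P g -> P (f + g)) ->
  (forall i f, P f -> P ('X_i * f)) -> forall f, P f.
Proof.
move=> PC PD PX f; rewrite [f]mpolyE; elim: (msupp f) => [|k ks IHk].
  by rewrite big_nil -mpolyC0.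
rewrite big_cons; apply: PD => //; rewrite -mul_mpolyC mpolyXE_id.
elim: (index_enum _) => [|i r IHr]; first by rewrite big_nil mulr1.
rewrite big_cons mulrCA; elim: (k i) => [|d IHd]; first by rewrite expr0 mul1r.
by rewrite exprS -mulrA; exact: PX.
Qed.

Lemma mderiv_comp N k f (X : n.-tuple {mpoly F[N]}) :
  (f \mPo X)^`M(k) = \sum_s (f^`M(s) \mPo X) * (tnth X s)^`M(k).
Proof.
elim/mpoly_mulX_ind: f => [c|f g IHf IHg|i f IHf].
- by rewrite comp_mpolyC mderivC big1 // => s _; rewrite mderivC comp_mpoly0 mul0r.
- rewrite comp_mpolyD mderivD IHf IHg -big_split /=.
  by apply: eq_bigr => s _; rewrite mderivD comp_mpolyD mulrDl.
rewrite rmorphM /= mderivM IHf comp_mpolyXU -tnth_nth mulr_sumr.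
under [RHS]eq_bigr => s _ do rewrite mderivM comp_mpolyD mulrDl !rmorphM /=.
rewrite big_split /=; congr (_ + _).
  rewrite (bigD1 i) //= mderivX mnm1E eqxx scale1r.
  have -> : (U_(i) - U_(i) = 0 :> 'X_{1..n})%MM.
    by apply/mnmP => j; rewrite mnmE subnn mnm0E.
  rewrite mpolyX0 rmorph1 mul1r mulrC big1 ?addr0 // => s si.
  by rewrite mderivX mnm1E eq_sym (negPf si) scale0r comp_mpoly0 !mul0r.
by apply: eq_bigr => s _; rewrite comp_mpolyXU -tnth_nth mulrA.
Qed.

Definition euler f := \sum_s 'X_s * f^`M(s).

Lemma mderivXU i s : ('X_i : {mpoly F[n]})^`M(s) = (i == s)%:R.
Proof.
rewrite mderivX mnm1E; case: eqP => [->|_]; last by rewrite scale0r.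
by rewrite scale1r -mpolyX0; congr 'X_[_]; apply/mnmP => j; rewrite mnmE subnn mnm0E.
Qed.

Lemma mcoeff_mulXderiv s f k : ('X_s * f^`M(s))@_k = f@_k *+ k s.
Proof.
elim/mpolyind: f => [|c u f _ _ IHf].
  by rewrite raddf0 mulr0 mcoeff0 mul0rn.
rewrite mderivD mulrDr !mcoeffD IHf mulrnDl; congr (_ + _).
rewrite mderivZ -scalerAr !mcoeffZ mderivX -scalerAr mcoeffZ.
have [u0|u_gt0] := posnP (u s).
  rewrite u0 mul0r mulr0 mcoeffX; case: eqP => [<-|_]; first by rewrite u0.
  by rewrite mulr0 mul0rn.
rewrite -mpolyXD addmC submK ?lep1mP -?lt0n // mcoeffX.
by case: eqP => [<-|_]; rewrite ?mulr0 ?mul0rn // !mulr1 mulr_natr.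
Qed.

Lemma mcoeff_euler f k : (euler f)@_k = f@_k *+ mdeg k.
Proof.
rewrite /euler raddf_sum /= mdegE -sumrMnr.
by apply: eq_bigr => s _; rewrite mcoeff_mulXderiv.
Qed.

Lemma eulerM f g : euler (f * g) = euler f * g + f * euler g.
Proof.
rewrite /euler mulr_suml mulr_sumr -big_split /=.
by apply: eq_bigr => s _; rewrite mderivM; ring.
Qed.

Lemma eulerX s : euler 'X_s = 'X_s.
Proof.
rewrite /euler (bigD1 s) //= mderivXU eqxx mulr1 big1 ?addr0 // => i si.
by rewrite mderivXU eq_sym (negPf si) mulr0.
Qed.

Fact euler_is_linear : linear euler.
Proof.
move=> c f g; rewrite /euler scaler_sumr -big_split /=.
by apply: eq_bigr => s _; rewrite mderivD mderivZ mulrDr scalerAr.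
Qed.
HB.instance Definition _ :=
  GRing.isLinear.Build F {mpoly F[n]} {mpoly F[n]} _ euler euler_is_linear.

Lemma euler_mderiv f s : euler f^`M(s) = (euler f)^`M(s) - f^`M(s).
Proof.
apply/eqP; rewrite eq_sym subr_eq; apply/eqP.
rewrite /euler raddf_sum /=.
under eq_bigr do rewrite mderivM mderivXU mderiv_comm.
rewrite big_split /= addrC; congr (_ + _).
rewrite (bigD1 s) //= eqxx mul1r big1 ?addr0 // => i si.
by rewrite (negPf si) mul0r.
Qed.

(** The degree is a scalar rather than a natural number, so that derivatives have degree d - 1
    without truncation at 0. *)
Definition hom_deg (d : F) f := euler f = d *: f.

Lemma hom_degZ d c f : hom_deg d f -> hom_deg d (c *: f).
Proof. by rewrite /hom_deg linearZ /= => ->; rewrite !scalerA mulrC. Qed.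

Lemma hom_degD d f g : hom_deg d f -> hom_deg d g -> hom_deg d (f + g).
Proof. by rewrite /hom_deg raddfD /= => -> ->; rewrite scalerDr. Qed.

Lemma hom_degB d f g : hom_deg d f -> hom_deg d g -> hom_deg d (f - g).
Proof. by rewrite /hom_deg raddfB /= => -> ->; rewrite scalerBr. Qed.

Lemma hom_deg_sum d I (r : seq I) (f_ : I -> {mpoly F[n]}) :
  (forall j, hom_deg d (f_ j)) -> hom_deg d (\sum_(j <- r) f_ j).
Proof.
move=> hf; elim: r => [|j r IHr]; last by rewrite big_cons; exact: hom_degD.
by rewrite big_nil /hom_deg linear0 scaler0.
Qed.

Lemma hom_deg_mulX d s f : hom_deg d f -> hom_deg (d + 1) ('X_s * f).
Proof.
by rewrite /hom_deg eulerM eulerX addrC => ->; rewrite scalerDl scale1r scalerAr.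
Qed.

Lemma hom_deg_mderiv d s f : hom_deg d f -> hom_deg (d - 1) f^`M(s).
Proof.
by rewrite /hom_deg euler_mderiv => ->; rewrite mderivZ scalerBl scale1r.
Qed.

End MpolyCalculus.

(** * The Gaudin Hamiltonians as differential operators *)

Section Gaudin.
Variables (F : fieldType) (n : nat) (z m : 'I_n -> F).
Implicit Types (f g : {mpoly F[n]}) (r s : 'I_n).

(* e_21^(r) e_12^(s) - e_11^(r) e_22^(s), normally ordered: it is 0 if r = s. *)
Definition casimir r s f : {mpoly F[n]} :=
  'X_r * 'X_s * f^`M(r)^`M(s) - 'X_r * 'X_s * f^`M(s)^`M(s)
  - m r *: ('X_s * f^`M(s)) + m s *: ('X_r * f^`M(s)).

Fact casimir_is_linear r s : linear (casimir r s).
Proof.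
move=> c f g; rewrite /casimir !(mderivD, mderivZ) -!mul_mpolyC; ring.
Qed.
HB.instance Definition _ r s :=
  GRing.isLinear.Build F {mpoly F[n]} {mpoly F[n]} _ (casimir r s)
    (casimir_is_linear r s).

Lemma hom_deg_casimir d r s f : hom_deg d f -> hom_deg d (casimir r s f).
Proof.
move=> hf.
have h1 i j : hom_deg d ('X_i * f^`M(j)).
  by rewrite -[d](subrK 1); apply/hom_deg_mulX/hom_deg_mderiv.
have h2 i : hom_deg d ('X_r * 'X_s * f^`M(i)^`M(s)).
  rewrite -mulrA -[d](subrK 1); apply: hom_deg_mulX.
  by rewrite -[d - 1](subrK 1); apply/hom_deg_mulX/hom_deg_mderiv/hom_deg_mderiv.
apply: hom_degD; last exact: hom_degZ.
by apply: hom_degB; [exact: hom_degB | exact: hom_degZ].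
Qed.

(* The summand r = s is 0, since gap z s s = 0^-1 = 0. *)
Definition gaudin s f : {mpoly F[n]} :=
  \sum_r gap z r s *: (casimir r s f + casimir s r f).

Fact gaudin_is_linear s : linear (gaudin s).
Proof.
move=> c f g; rewrite /gaudin scaler_sumr -big_split /=; apply: eq_bigr => r _.
by rewrite !linearP /= -!mul_mpolyC; ring.
Qed.
HB.instance Definition _ s :=
  GRing.isLinear.Build F {mpoly F[n]} {mpoly F[n]} _ (gaudin s)
    (gaudin_is_linear s).

Lemma hom_deg_gaudin d s f : hom_deg d f -> hom_deg d (gaudin s f).
Proof.
move=> hf; apply: hom_deg_sum => r; apply: hom_degZ.
by apply: hom_degD; exact: hom_deg_casimir.
Qed.

(** [gap] is antisymmetric in r, s, whereas the operator that it multiplies is symmetric. *)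
Lemma sum_gaudin f : \sum_s gaudin s f = 0.
Proof.
rewrite /gaudin; under eq_bigr => s _ do under eq_bigr do rewrite scalerDr.
under eq_bigr do rewrite big_split /=.
rewrite big_split /= [X in X + _]exchange_big -big_split /= big1 // => s _.
rewrite -big_split big1 //= => r _.
by rewrite gapC scaleNr addNr.
Qed.

(** This is the action of e_12, see [gl2_act_raising]; [euler] is that of e_22. *)
Definition raising f : {mpoly F[n]} :=
  \sum_s (m s *: f^`M(s) - 'X_s * f^`M(s)^`M(s)).

Lemma casimir_diag s f : casimir s s f = 0.
Proof. by rewrite /casimir subrr sub0r addNr. Qed.

Hypothesis z_inj : injective z.

(** Exchanging r and s in half of the terms produces (z_s - z_r) / (z_r - z_s) = -1, so the z_s
    disappear. *)
Lemma sum_z_gaudin f : \sum_s z s *: gaudin s f = - \sum_r \sum_s casimir r s f.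
Proof.
rewrite /gaudin; under eq_bigr => s _ do rewrite scaler_sumr.
under eq_bigr => s _ do
  under eq_bigr do rewrite scalerA scalerDr.
under eq_bigr do rewrite big_split /=.
rewrite big_split /= [X in X + _]exchange_big -big_split -sumrN /=.
apply: eq_bigr => r _; rewrite -big_split -sumrN /=; apply: eq_bigr => s _.
have [->|rs] := eqVneq r s; first by rewrite casimir_diag !scaler0 addr0 oppr0.
rewrite -scalerDl [gap z s r]gapC mulrN -mulrBl mulrC -opprB mulrN gapK //.
by rewrite scaleN1r.
Qed.

(** Origin of the constant in q_0: on forms of degree l the last two terms give l^2 - (1 + \sum_s
    m_s) l = - l (\sum_s m_s + 1 - l), and the first term vanishes exactly on vectors killed by
    e_12. *)
Lemma sum_casimir f :
  \sum_r \sum_s casimir r s f =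
  (\sum_s 'X_s) * raising f + euler (euler f) - (1 + \sum_s m s) *: euler f.
Proof.
have casimirE r s : casimir r s f = 'X_r * 'X_s * f^`M(r)^`M(s)
    + 'X_r * (m s *: f^`M(s) - 'X_s * f^`M(s)^`M(s)) - m r *: ('X_s * f^`M(s)).
  by rewrite /casimir -!mul_mpolyC; ring.
under eq_bigr => r _.
  under eq_bigr do rewrite casimirE.
  rewrite big_split sumrN big_split /=; over.
rewrite big_split sumrN big_split /=.
have -> : euler (euler f) =
   \sum_r \sum_s 'X_r * 'X_s * f^`M(r)^`M(s) + euler f.
  transitivity (\sum_r 'X_r * (\sum_s 'X_s * f^`M(s))^`M(r)); first by [].
  rewrite /euler -big_split /=; apply: eq_bigr => r _.
  rewrite raddf_sum /=.
  under eq_bigr do rewrite mderivM mderivXU mderiv_comm.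
  rewrite big_split /= mulrDr [LHS]addrC; congr (_ + _).
    by rewrite mulr_sumr; apply: eq_bigr => s _; rewrite mulrA.
  rewrite (bigD1 r) //= eqxx mul1r big1 ?addr0 // => s sr.
  by rewrite (negPf sr) mul0r.
have -> : (\sum_s 'X_s) * raising f =
   \sum_r \sum_s 'X_r * (m s *: f^`M(s) - 'X_s * f^`M(s)^`M(s)).
  by rewrite mulr_suml; apply: eq_bigr => r _; rewrite mulr_sumr.
have -> : \sum_r \sum_s m r *: ('X_s * f^`M(s)) = (\sum_s m s) *: euler f.
  by rewrite scaler_suml; apply: eq_bigr => r _; rewrite scaler_sumr.
rewrite scalerDl scale1r; ring.
Qed.

End Gaudin.

(** * Lagrange interpolation at the points z_s *)

Section LagrangeFormula.
Variables (F : fieldType) (N : nat) (z : 'I_N.+1 -> F).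
Hypothesis z_inj : injective z.

Definition lagrange_coef (s : 'I_N.+1) : F := (conode_poly z s).[z s]^-1.

Lemma lagrange_coef_neq0 s : lagrange_coef s != 0.
Proof. by rewrite invr_eq0 conode_poly_neq0. Qed.

Lemma lagrange (q : {poly F}) : (size q <= N.+1)%N ->
  q = \sum_s (lagrange_coef s * q.[z s]) *: conode_poly z s.
Proof.
move=> sq; apply/eqP; rewrite -subr_eq0; apply/eqP.
pose rs := [seq z s | s : 'I_N.+1].
apply: (@roots_geq_poly_eq0 _ _ rs); last 2 first.
- by rewrite map_inj_uniq // enum_uniq.
- rewrite size_map -cardE card_ord.
  apply: leq_trans (size_polyD _ _) _; rewrite geq_max sq size_polyN.
  apply: leq_trans (size_sum _ _ _) _; apply/bigmax_leqP => s _.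
  by rewrite (leq_trans (size_scale_leq _ _)) ?size_conode.
apply/allP => _ /mapP [r _ ->]; apply/rootP.
rewrite hornerD hornerN horner_sum (bigD1 r) //= big1 ?addr0 => [|s sr].
  by rewrite hornerZ mulrAC mulVf ?mul1r ?subrr // conode_poly_neq0.
by rewrite hornerZ conode_poly_root ?mulr0 // eq_sym.
Qed.

(** The coefficients of [Q] lie in [K] but the nodes come from F: by linearity it suffices to
    interpolate monomials, and these are defined over F. *)
Lemma lagrange_morph (K : comNzRingType) (iota : {rmorphism F -> K})
    (Q : {poly K}) (t : K) : (size Q <= N.+1)%N ->
  \sum_s (map_poly iota (conode_poly z s)).[t]
         * (iota (lagrange_coef s) * Q.[iota (z s)]) = Q.[t].
Proof.
move=> sQ; rewrite [RHS]horner_coef.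
under eq_bigr do rewrite [Q.[iota _]]horner_coef !mulr_sumr.
rewrite exchange_big /=; apply: eq_bigr => i _.
have iN : (size ('X^i : {poly F}) <= N.+1)%N.
  by rewrite size_polyXn (leq_trans (ltn_ord i)).
have -> : t ^+ i = (map_poly iota 'X^i).[t] by rewrite map_polyXn hornerXn.
rewrite [in RHS](lagrange iN) raddf_sum horner_sum mulr_sumr.
apply: eq_bigr => s _.
rewrite /= map_polyZ hornerZ hornerXn.
by rewrite rmorphM rmorphXn /=; ring.
Qed.

Variable (K : comAlgType F).

(** Comparison of the coefficients of t^N in the Lagrange formula, the A_s being monic of degree
    N. *)
Lemma lagrange_alg_sum (Q : {poly K}) : (size Q <= N)%N ->
  \sum_s lagrange_coef s *: Q.[(z s)%:A] = 0.
Proof.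
move=> sQ; under eq_bigr do rewrite horner_coef scaler_sumr.
rewrite exchange_big big1 //= => i _.
have iN : (size ('X^i : {poly F}) <= N.+1)%N.
  by rewrite size_polyXn ltnW ?ltnS // (leq_trans (ltn_ord i)).
under eq_bigr do rewrite exprZn expr1n mulr_algr scalerA.
rewrite -scaler_suml [X in X *: _](_ : _ = 0) ?scale0r //.
have := congr1 (fun q : {poly F} => q`_N) (lagrange iN).
rewrite coefXn gtn_eqF ?(leq_trans (ltn_ord i)) // coef_sum => sum0.
rewrite -[RHS]/(false%:R) [RHS]sum0.
apply: eq_bigr => s _; rewrite coefZ hornerXn -[LHS]mulr1; congr (_ * _).
by have /monicP := monic_conode z s; rewrite /lead_coef size_conode.
Qed.

End LagrangeFormula.

(** * The separated coordinates y_k and the separated equations *)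

Section SeparatedVariables.
Variables (F : fieldType) (N : nat) (z m : 'I_N.+1 -> F).
Hypothesis z_inj : injective z.
Implicit Types (f : {mpoly F[N.+1]}) (P : {mpoly F[N]}) (k : 'I_N).

Definition eval_at k (q : {poly F}) : {mpoly F[N]} := horner_alg 'X_k q.

(** The coefficient of A_s when \prod_k (y_k - t) is interpolated at the z_s. *)
Definition sep_coord (s : 'I_N.+1) : {mpoly F[N]} :=
  lagrange_coef z s *: \prod_k ('X_k - (z s)%:A).

(* The substitution expressing x_1, ..., x_n through the roots y_k of
   \sum_s x_s A_s(t) = \prod_k (y_k - t). *)
Definition sep : {mpoly F[N.+1]} -> {mpoly F[N]} :=
  comp_mpoly [tuple sep_coord s | s < N.+1].

HB.instance Definition _ :=
  GRing.RMorphism.copy sep (comp_mpoly [tuple sep_coord s | s < N.+1]).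
HB.instance Definition _ :=
  GRing.Linear.copy sep (comp_mpoly [tuple sep_coord s | s < N.+1]).

Lemma sepX s : sep 'X_s = sep_coord s.
Proof. by rewrite /sep comp_mpolyXU -tnth_nth tnth_mktuple. Qed.

Lemma sep_coord_neq0 s : sep_coord s != 0.
Proof.
rewrite scaler_eq0 negb_or lagrange_coef_neq0 //= prodf_seq_neq0.
apply/allP => k _; rewrite alg_mpolyC; apply/eqP => /(congr1 (mcoeff U_(k))).
rewrite mcoeffB mcoeffXU mcoeffC mcoeff0 eqxx mnm1_eq0 mulr0 subr0.
by apply/eqP; rewrite oner_eq0.
Qed.

(** x_s / (y_k - z_s). It is at once the derivative of x_s in y_k and the w_s of
    [separation_identity], and it does not involve y_k. *)
Definition sep_weight k (s : 'I_N.+1) : {mpoly F[N]} :=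
  lagrange_coef z s *: \prod_(j < N | j != k) ('X_j - (z s)%:A).

Lemma sep_coordE k s : sep_coord s = ('X_k - (z s)%:A) * sep_weight k s.
Proof. by rewrite /sep_coord (bigD1 k) //= scalerAr. Qed.

(** Without its k-th factor the interpolated product has degree N - 1, too small for a coefficient
    of t^N. *)
Lemma sum_sep_weight k : \sum_s sep_weight k s = 0.
Proof.
pose Q : {poly {mpoly F[N]}} := \prod_(j < N | j != k) (('X_j)%:P - 'X).
rewrite -[RHS](@lagrange_alg_sum _ _ _ z_inj {mpoly F[N]} Q).
  apply: eq_bigr => s _; rewrite horner_prod.
  by under [in RHS]eq_bigr do rewrite !hornerE.
apply: leq_trans (size_poly_prod_leq _ _) _.
rewrite (eq_bigr (fun=> 2%N)) => [|j _]; last by rewrite -opprB size_polyN size_XsubC.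
rewrite sum_nat_const muln2 -addnn subSn ?leq_addr // addnK.
by have := cardC (pred1 k); rewrite card_ord card1 add1n => cE; exact: eq_leq.
Qed.

Lemma mderiv_sep_weight k s : (sep_weight k s)^`M(k) = 0.
Proof.
rewrite mderivZ; apply/eqP; rewrite scaler_eq0; apply/orP; right; apply/eqP.
apply: (big_ind (fun P => P^`M(k) = 0)) => [|P Q P0 Q0|j jk].
- by rewrite -mpolyC1 mderivC.
- by rewrite mderivM P0 Q0 mul0r mulr0 addr0.
by rewrite alg_mpolyC mderivB mderivC mderivXU (negPf jk) subr0.
Qed.

Lemma mderiv_sep_coord k s : (sep_coord s)^`M(k) = sep_weight k s.
Proof.
rewrite (sep_coordE k) mderivM mderiv_sep_weight mulr0 addr0.
by rewrite alg_mpolyC mderivB mderivC mderivXU eqxx subr0 mul1r.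
Qed.

Lemma mderiv_sep k f : (sep f)^`M(k) = \sum_s sep f^`M(s) * sep_weight k s.
Proof.
rewrite mderiv_comp; apply: eq_bigr => s _.
by rewrite tnth_mktuple mderiv_sep_coord.
Qed.

Lemma sep_casimir r s f :
  sep (casimir m r s f) =
  sep_coord r * sep_coord s * sep f^`M(r)^`M(s)
  - sep_coord r * sep_coord s * sep f^`M(s)^`M(s)
  - (m r)%:A * sep_coord s * sep f^`M(s) + (m s)%:A * sep_coord r * sep f^`M(s).
Proof.
rewrite /casimir !(raddfD, raddfB) /= !linearZ /= !rmorphM /= !sepX.
by rewrite !raddfN /= !rmorphM /= !sepX ?scalerN -!mulrA !mulr_algl.
Qed.

Definition sep_oper k P : {mpoly F[N]} :=
  eval_at k (node_poly z) * P^`M(k)^`M(k)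
  - eval_at k (mass_poly z m) * P^`M(k).

(** By the chain rule the derivative in y_k is \sum_s w_s d_s; as the w_s do not involve y_k, the
    second derivative is \sum_r \sum_s w_r w_s d_r d_s, and [separation_identity] applies. *)
Lemma separation k f :
  sep_oper k (sep f)
  + \sum_s eval_at k (conode_poly z s) * sep (gaudin z m s f) = 0.
Proof.
rewrite -[RHS](@separation_identity _ _ z m {mpoly F[N]} z_inj 'X_k
   (sep_weight k) (fun s => sep f^`M(s)) (fun r s => sep f^`M(r)^`M(s))); last first.
  exact: sum_sep_weight.
rewrite /sep_oper -/(eval_at _ _) -/(eval_at _ _); congr (_ * _ - _ * _ + _).
- rewrite mderiv_sep raddf_sum /= exchange_big /=; apply: eq_bigr => s _.
  rewrite mderivM mderiv_sep_weight mulr0 addr0 mderiv_sep mulr_suml.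
  by apply: eq_bigr => r _; rewrite mderiv_comm; ring.
- by rewrite mderiv_sep; apply: eq_bigr => s _; rewrite mulrC.
apply: eq_bigr => s _; congr (_ * _); rewrite /gaudin raddf_sum /=.
apply: eq_bigr => r _; rewrite linearZ /= [RHS]mulr_algl; congr (_ *: _).
by rewrite -!sep_coordE raddfD /= !sep_casimir.
Qed.

End SeparatedVariables.

Section HomDeg.
Variables (F : fieldType) (n : nat).
Hypothesis charF0 : [pchar F] =i pred0.

Lemma hom_degP (d : nat) (f : {mpoly F[n]}) :
  hom_deg d%:R f <-> (forall k, mdeg k != d -> f@_k = 0).
Proof.
split=> [hf k kd|hf]; last first.
  apply/mpolyP => k; rewrite mcoeff_euler mcoeffZ mulr_natl.
  by have [->//|/hf ->] := eqVneq (mdeg k) d; rewrite !mul0rn.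
have /eqP := congr1 (mcoeff k) hf.
rewrite mcoeff_euler mcoeffZ -[_ *+ mdeg k]mulr_natl -subr_eq0 -mulrBl mulf_eq0.
have natf0 := (pcharf0P F).1 charF0.
have natf_inj : injective (fun i : nat => i%:R : F).
  move=> i j; wlog ij : i j / (i <= j)%N => [th|] eij.
    by case/orP: (leq_total i j) => /th ->.
  have := natf0 (j - i)%N; rewrite natrB // eij subrr eqxx => /esym.
  by rewrite subn_eq0 => ji; apply/eqP; rewrite eqn_leq ij.
by rewrite subr_eq0 (inj_eq natf_inj) (negPf kd) => /eqP.
Qed.

End HomDeg.

(** * Injectivity of the substitution on forms, and commutativity of the Hamiltonians *)

Section SeparationInjectivity.
Variables (F : fieldType) (N : nat) (z m : 'I_N.+1 -> F).
Hypothesis z_inj : injective z.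
Hypothesis charF0 : [pchar F] =i pred0.
Implicit Types (f : {mpoly F[N.+1]}) (k : 'I_N).

(** The polynomial \sum_r W_r A_r(t) has degree below N by the first hypothesis and the N distinct
    roots y_k by the second, so it is 0; at t = z_s only W_s survives. *)
Lemma eval_at_interpolation (W : 'I_N.+1 -> {mpoly F[N]}) :
  \sum_s W s = 0 ->
  (forall k, \sum_s eval_at k (conode_poly z s) * W s = 0) ->
  forall s, W s = 0.
Proof.
move=> sumW evW s.
pose cA r := map_poly (in_alg {mpoly F[N]}) (conode_poly z r).
pose P : {poly {mpoly F[N]}} := \sum_r W r *: cA r.
have P0 : P = 0.
  apply: (@roots_geq_poly_eq0 _ _ [seq ('X_k : {mpoly F[N]}) | k <- enum 'I_N]).
  - apply/allP => _ /mapP [k _ ->]; apply/rootP; rewrite -[RHS](evW k).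
    rewrite horner_sum; apply: eq_bigr => r _; rewrite hornerZ mulrC.
    by congr (_ * _).
  - rewrite map_inj_uniq ?enum_uniq // => i j /(congr1 (mcoeff U_(i))).
    by rewrite !mcoeffXU eqxx; case: eqP => [->//|_] /eqP; rewrite oner_eq0.
  rewrite size_map -cardE card_ord; apply/leq_sizeP => j Nj.
  rewrite coef_sum; under eq_bigr do rewrite coefZ coef_map /=.
  have [->|jN] := eqVneq j N.
    rewrite -[RHS]sumW; apply: eq_bigr => r _.
    have /monicP := monic_conode z r; rewrite /lead_coef size_conode /= => ->.
    by rewrite scale1r mulr1.
  rewrite big1 // => r _; rewrite nth_default ?scale0r ?mulr0 //.
  by rewrite size_conode ltn_neqAle eq_sym jN.
have /eqP := congr1 (horner^~ (z s)%:A) P0.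
rewrite horner0 horner_sum (bigD1 s) //= big1 ?addr0 => [|r rs].
  rewrite hornerZ horner_map /= mulf_eq0 => /orP [/eqP //|].
  by rewrite scaler_eq0 oner_eq0 orbF (negPf (conode_poly_neq0 z_inj s)).
by rewrite hornerZ horner_map /= conode_poly_root 1?eq_sym // scale0r mulr0.
Qed.

(* The Jacobian of the change of variables, completed by Euler's identity, is
   invertible: hence the derivatives of a polynomial in the kernel are in the
   kernel too. *)
Lemma sep_inj d f : hom_deg d%:R f -> sep z f = 0 -> f = 0.
Proof.
have natf0 := (pcharf0P F).1 charF0.
elim: d f => [|d IHd] f hf sf.
  have fE : f = (f@_0)%:MP.
    apply/mpolyP => k; rewrite mcoeffC; case: eqP => [->|/eqP k0].
      by rewrite mulr1.
    by rewrite mulr0 ((hom_degP charF0 0 f).1 hf) // mdeg_eq0.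
  move: sf; rewrite fE /sep comp_mpolyC => /eqP; rewrite mpolyC_eq0 => /eqP ->.
  by rewrite mpolyC0.
have df s : f^`M(s) = 0.
  apply: IHd; first by have := hom_deg_mderiv s hf; rewrite -natr1 addrK.
  (* The images of x_s d_s f add up to a multiple of [sep z f], and by A_s(y_k) x_s = A(y_k) w_s
     their other combinations are A(y_k) times the y_k-derivative of [sep z f]. All of these
     vanish. *)
  have /eqP : sep_coord z s * sep z f^`M(s) = 0.
    apply: (eval_at_interpolation (W := fun s => sep_coord z s * sep z f^`M(s))).
      transitivity (sep z (euler f)); last by rewrite hf linearZ /= sf scaler0.
      by rewrite raddf_sum; apply: eq_bigr => r _; rewrite /= rmorphM /= sepX.
    move=> k; transitivity (eval_at k (node_poly z) * (sep z f)^`M(k)).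
      rewrite mderiv_sep mulr_sumr; apply: eq_bigr => r _.
      rewrite (sep_coordE z k) (node_polyE z r) /eval_at rmorphM rmorphB /=.
      by rewrite horner_algX horner_algC; ring.
    by rewrite sf raddf0 mulr0.
  by rewrite mulf_eq0 (negPf (sep_coord_neq0 z_inj s)) => /eqP.
have /eqP := hf; rewrite /euler big1 => [|s _]; last by rewrite df mulr0.
by rewrite eq_sym scaler_eq0 natf0 /= => /eqP.
Qed.

Lemma mderiv_eval_at j k (q : {poly F}) : j != k -> (eval_at k q)^`M(j) = 0.
Proof.
move=> jk; elim/poly_ind: q => [|q c IHq]; first by rewrite /eval_at !raddf0.
rewrite /eval_at rmorphD rmorphM /= horner_algX horner_algC alg_mpolyC.
rewrite mderivD mderivC addr0 mderivM IHq mul0r add0r mderivXU eq_sym.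
by rewrite (negPf jk) mulr0.
Qed.

Lemma sep_operC j k P : j != k ->
  sep_oper z m j (sep_oper z m k P) = sep_oper z m k (sep_oper z m j P).
Proof.
move=> jk; have kj : k != j by rewrite eq_sym.
rewrite /sep_oper !(mderivB, mderivM, mderiv_eval_at _ jk, mderiv_eval_at _ kj).
rewrite !(mul0r, add0r) !(mderivM, mderivB, mderiv_eval_at _ jk, mderiv_eval_at _ kj).
rewrite !(mul0r, add0r) !(mderiv_comm k j); ring.
Qed.

Fact sep_oper_is_linear k : linear (sep_oper z m k).
Proof.
by move=> c P Q; rewrite /sep_oper !(mderivD, mderivZ) -!mul_mpolyC; ring.
Qed.
HB.instance Definition _ k :=
  GRing.isLinear.Build F {mpoly F[N]} {mpoly F[N]} _ (sep_oper z m k)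
    (sep_oper_is_linear k).

Lemma sep_oper_mulr j k (q : {poly F}) P : j != k ->
  sep_oper z m j (eval_at k q * P) = eval_at k q * sep_oper z m j P.
Proof.
by move=> jk; rewrite /sep_oper !(mderivM, mderiv_eval_at _ jk, mul0r, add0r); ring.
Qed.

Lemma sep_oper_sep k f :
  sep_oper z m k (sep z f) =
  - \sum_s eval_at k (conode_poly z s) * sep z (gaudin z m s f).
Proof. by apply/eqP; rewrite -addr_eq0 separation. Qed.

Lemma sep_oper2 j k f : j != k ->
  sep_oper z m j (sep_oper z m k (sep z f)) =
  \sum_s \sum_t eval_at k (conode_poly z s) * (eval_at j (conode_poly z t) *
     sep z (gaudin z m t (gaudin z m s f))).
Proof.
move=> jk; rewrite sep_oper_sep raddfN raddf_sum -sumrN; apply: eq_bigr => s _.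
by rewrite /= sep_oper_mulr // sep_oper_sep mulrN opprK mulr_sumr.
Qed.

Lemma gaudinC d f : hom_deg d%:R f ->
  forall s t, gaudin z m s (gaudin z m t f) = gaudin z m t (gaudin z m s f).
Proof.
move=> hf s t; apply/eqP; rewrite -subr_eq0; apply/eqP.
have hH q g : hom_deg d%:R g -> hom_deg d%:R (gaudin z m q g).
  exact: hom_deg_gaudin.
apply: (@sep_inj d); first by apply: hom_degB; apply/hH/hH.
move: t s.
pose E s t := gaudin z m s (gaudin z m t f) - gaudin z m t (gaudin z m s f).
suff E0 s t : sep z (E s t) = 0 by move=> t s; exact: E0.
have sumE1 t' : \sum_s' E s' t' = 0.
  transitivity (\sum_s' gaudin z m s' (gaudin z m t' f)
                - gaudin z m t' (\sum_s' gaudin z m s' f)).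
    by rewrite (raddf_sum (gaudin z m t')) -sumrB.
  by rewrite !sum_gaudin raddf0 subr0.
have sumE2 s' : \sum_t' E s' t' = 0.
  transitivity (gaudin z m s' (\sum_t' gaudin z m t' f)
                - \sum_t' gaudin z m t' (gaudin z m s' f)).
    by rewrite (raddf_sum (gaudin z m s')) -sumrB.
  by rewrite !sum_gaudin raddf0 subr0.
(* For j different from k this is the commutation of the one-variable operators in y_j and y_k; for
   j = k the commutator is antisymmetric and the weights are symmetric, so nothing has to
   commute. *)
have evE j k : \sum_s' eval_at k (conode_poly z s') *
    (\sum_t' eval_at j (conode_poly z t') * sep z (E s' t')) = 0.
  pose G j k := \sum_s' \sum_t' eval_at k (conode_poly z s') *
    (eval_at j (conode_poly z t') * sep z (gaudin z m t' (gaudin z m s' f))).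
  have GC : G j k = G k j.
    have [->//|jk] := eqVneq j k; have kj : k != j by rewrite eq_sym.
    by rewrite /G -(sep_oper2 f jk) -(sep_oper2 f kj) sep_operC.
  transitivity (G k j - G j k); last by rewrite GC subrr.
  rewrite {1}/G exchange_big -sumrB; apply: eq_bigr => s' _.
  rewrite -sumrB mulr_sumr; apply: eq_bigr => t' _.
  by rewrite /E (raddfB (sep z)) !mulrBr; congr (_ - _); rewrite mulrCA.
(* Interpolation is applied twice, first in the index s and then in t. *)
have W0 j : \sum_t' eval_at j (conode_poly z t') * sep z (E s t') = 0.
  apply: (eval_at_interpolation (W := fun s' =>
    \sum_t' eval_at j (conode_poly z t') * sep z (E s' t'))) => [|k].
    rewrite exchange_big big1 //= => t' _.
    by rewrite -mulr_sumr -(raddf_sum (sep z)) sumE1 raddf0 mulr0.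
  exact: evE.
apply: (eval_at_interpolation (W := fun t' => sep z (E s t'))) => //.
by rewrite -(raddf_sum (sep z)) sumE2 raddf0.
Qed.

End SeparationInjectivity.

(** * The gl_2 action by differential operators, and singular vectors *)

Section SingularVectors.
Variables (F : fieldType) (n : nat) (m : 'I_n -> F).
Implicit Types (v : {mpoly F[n]}) (s : 'I_n).

Lemma mderiv_eval_at_diag s (q : {poly F}) : (eval_at s q)^`M(s) = eval_at s q^`().
Proof.
elim/poly_ind: q => [|q c IHq]; first by rewrite /eval_at !(deriv0, raddf0).
rewrite derivD derivC addr0 derivM derivX mulr1 /eval_at !rmorphD !rmorphM /=.
rewrite horner_algX horner_algC alg_mpolyC mderivD mderivC addr0 mderivM.
by rewrite -/(eval_at s q) IHq mderivXU eqxx mulr1.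
Qed.

Lemma on_factor_eval_at s (f : {poly F} -> {poly F}) (k : 'X_{1..n}) :
  on_factor s f 'X_[k] =
  eval_at s (f 'X^(k s)) * \prod_(r < n | r != s) 'X_r ^+ k r.
Proof.
rewrite on_factorX; congr (_ * _); rewrite /eval_at /horner_alg /horner_morph.
by congr (_.[_]); apply: eq_map_poly => c; rewrite /= alg_mpolyC.
Qed.

Lemma mderivX_eval_at s (k : 'X_{1..n}) (q : {poly F})
    (rest := \prod_(r < n | r != s) 'X_r ^+ k r : {mpoly F[n]}) :
  (eval_at s q * rest)^`M(s) = eval_at s q^`() * rest.
Proof.
rewrite mderivM mderiv_eval_at_diag [X in _ + _ * X](_ : _ = 0) ?mulr0 ?addr0 //.
rewrite /rest; apply: (big_ind (fun P => P^`M(s) = 0)) => [|P Q P0 Q0|r rs].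
- by rewrite -mpolyC1 mderivC.
- by rewrite mderivM P0 Q0 mul0r mulr0 addr0.
elim: (k r) => [|d IHd]; first by rewrite expr0 -mpolyC1 mderivC.
by rewrite exprS mderivM IHd mulr0 addr0 mderivXU (negPf rs) mul0r.
Qed.

Lemma mpolyX_eval_at s (k : 'X_{1..n}) :
  'X_[k] = eval_at s 'X^(k s) * \prod_(r < n | r != s) 'X_r ^+ k r :> {mpoly F[n]}.
Proof.
by rewrite mpolyXE_id (bigD1 s) //= /eval_at rmorphXn /= horner_algX.
Qed.

Let raise_factor s v := m s *: v^`M(s) - 'X_s * v^`M(s)^`M(s).
Let euler_factor s v := 'X_s * v^`M(s).

Fact raise_factor_is_linear s : linear (raise_factor s).
Proof.
by move=> c v w; rewrite /raise_factor !(mderivD, mderivZ) -!mul_mpolyC; ring.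
Qed.
HB.instance Definition _ s :=
  GRing.isLinear.Build F {mpoly F[n]} {mpoly F[n]} _ (raise_factor s)
    (raise_factor_is_linear s).

Fact euler_factor_is_linear s : linear (euler_factor s).
Proof.
by move=> c v w; rewrite /euler_factor !(mderivD, mderivZ) -!mul_mpolyC; ring.
Qed.
HB.instance Definition _ s :=
  GRing.isLinear.Build F {mpoly F[n]} {mpoly F[n]} _ (euler_factor s)
    (euler_factor_is_linear s).

Lemma on_factor_linear s f (L : {linear {mpoly F[n]} -> {mpoly F[n]}}) v :
  (forall k, on_factor s f 'X_[k] = L 'X_[k]) -> on_factor s f v = L v.
Proof.
move=> fL; rewrite [in RHS](mpolyE v) [RHS]raddf_sum /on_factor.
by apply: eq_bigr => k _; rewrite -on_factorX fL /= linearZ.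
Qed.

Lemma gl2_act_raising v : gl2_act m idx1 idx2 v = raising m v.
Proof.
apply: eq_bigr => s _; apply: (on_factor_linear (L := raise_factor s)) => k.
rewrite on_factor_eval_at /verma /= /raise_factor.
rewrite (mpolyX_eval_at s k) !mderivX_eval_at.
rewrite /eval_at raddfB /= linearZ /= rmorphM /= horner_algX mulrBl -mulrA.
by rewrite mulr_algl -?scalerAl -?mulrA.
Qed.

Lemma gl2_act_euler v : gl2_act m idx2 idx2 v = euler v.
Proof.
apply: eq_bigr => s _; apply: (on_factor_linear (L := euler_factor s)) => k.
rewrite on_factor_eval_at /verma /= /euler_factor.
rewrite (mpolyX_eval_at s k) !mderivX_eval_at.
by rewrite /eval_at rmorphM /= horner_algX mulrA.
Qed.

Lemma is_singE l v : is_sing m l v <-> raising m v = 0 /\ hom_deg l%:R v.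
Proof. by rewrite /is_sing gl2_act_raising gl2_act_euler. Qed.

End SingularVectors.

Section Spectrum.
Variables (F : fieldType) (N l : nat) (z m : 'I_N.+1 -> F).
Hypothesis z_inj : injective z.
Hypothesis charF0 : [pchar F] =i pred0.

Definition top_weight : F := l%:R * (\sum_s m s + 1 - l%:R).

Definition in_sing (v : {mpoly F[N.+1]}) : Prop :=
  hom_deg l%:R v /\ \sum_s z s *: gaudin z m s v = top_weight *: v.

(** On forms of degree l, \sum_s z_s H_s equals [top_weight] minus (\sum_s x_s) e_12. Singularity
    thus becomes an eigenvalue condition, which the commuting H_s visibly preserve. *)
Lemma is_sing_gaudin v : is_sing m l v <-> in_sing v.
Proof.
rewrite is_singE; suff E : hom_deg l%:R v ->
    \sum_s z s *: gaudin z m s v = top_weight *: v - (\sum_s 'X_s) * raising m v.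
  split=> [[rv hv]|[hv zv]]; split => //; first by rewrite E // rv mulr0 subr0.
  move: zv; rewrite E // => /eqP; rewrite subr_eq addrC -subr_eq subrr eq_sym.
  (* Polynomials form a domain, and \sum_s x_s is nonzero because its coefficient at the variable of
     index 0 is 1. *)
  rewrite mulf_eq0 => /orP [|/eqP //] /eqP/(congr1 (mcoeff U_(ord0))).
  rewrite raddf_sum /= (bigD1 ord0) //= big1 => [|s s0].
    by rewrite mcoeffXU eqxx addr0 mcoeff0 => /eqP; rewrite oner_eq0.
  by rewrite mcoeffXU (negPf s0).
move=> hv; rewrite sum_z_gaudin // sum_casimir hv linearZ /= hv /top_weight.
rewrite -!mul_mpolyC; ring.
Qed.

Lemma in_sing_gaudin s v : in_sing v -> in_sing (gaudin z m s v).
Proof.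
case=> hv zv; split; first exact: hom_deg_gaudin.
rewrite -linearZ -zv raddf_sum; apply: eq_bigr => r _ /=.
by rewrite linearZ /= (gaudinC m z_inj charF0 hv).
Qed.

Lemma in_singD v w : in_sing v -> in_sing w -> in_sing (v + w).
Proof.
case=> hv zv [hw zw]; split; first exact: hom_degD.
rewrite scalerDr -zv -zw -big_split; apply: eq_bigr => s _ /=.
by rewrite raddfD scalerDr.
Qed.

Lemma in_singZ c v : in_sing v -> in_sing (c *: v).
Proof.
case=> hv zv; split; first exact: hom_degZ.
rewrite scalerA mulrC -scalerA -zv scaler_sumr; apply: eq_bigr => s _ /=.
by rewrite linearZ /= !scalerA mulrC.
Qed.

End Spectrum.

(** * The triangular recursion for the coefficients of p *)

Section Recursion.
Variables (F : fieldType) (N l : nat) (z m : 'I_N.+1 -> F).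

(** t^2 (A p'' - B p') at p = t^d is t^d times this polynomial; the factor t^2 keeps all exponents
    natural. *)
Definition ode_coef (d : nat) : {poly F} :=
  (d * d.-1)%:R *: node_poly z - d%:R *: ('X * mass_poly z m).
Definition pot_coef (s : 'I_N.+1) : {poly F} := 'X^2 * conode_poly z s.

(* The coefficient of t^e in t^2 (A p'' - B p' + \sum_s h_s A_s p), where
   A = node_poly, B = mass_poly, A_s = conode_poly s, and b d and bh s d stand
   for the coefficients of t^d in p and in h_s p. *)
Definition ode_lhs (V : lmodType F) (b : nat -> V) (bh : 'I_N.+1 -> nat -> V)
    (e : nat) : V :=
  \sum_(d < e.+1) ((ode_coef d)`_(e - d) *: b d
                   + \sum_s (pot_coef s)`_(e - d) *: bh s d).

(** The part of the coefficient of t^(d+N+1) that comes from the terms of p above t^d. *)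
Definition ode_rest (V : lmodType F) (b : nat -> V) (bh : 'I_N.+1 -> nat -> V)
    (d : nat) : V :=
  \sum_(i < N.+1) ((ode_coef (d.+1 + i))`_(N - i) *: b (d.+1 + i)%N
                   + \sum_s (pot_coef s)`_(N - i) *: bh s (d.+1 + i)%N).

Definition ode_pivot (d : nat) : F :=
  (d * d.-1)%:R - d%:R * \sum_s m s + top_weight l m.

Lemma conode_lead s : (conode_poly z s)`_N = 1.
Proof. by have /monicP := monic_conode z s; rewrite /lead_coef size_conode. Qed.

Lemma mass_lead : (mass_poly z m)`_N = \sum_s m s.
Proof.
rewrite coef_sum; apply: eq_bigr => s _.
by rewrite coefZ conode_lead mulr1.
Qed.

Lemma size_mass : (size (mass_poly z m) <= N.+1)%N.
Proof.
apply: leq_trans (size_sum _ _ _) _; apply/bigmax_leqP => s _.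
by rewrite (leq_trans (size_scale_leq _ _)) ?size_conode.
Qed.

Lemma ode_coef_lead d : (ode_coef d)`_N.+1 = (d * d.-1)%:R - d%:R * \sum_s m s.
Proof.
rewrite coefB !coefZ coefXM /= mass_lead.
have /monicP := monic_node z; rewrite /lead_coef size_node /= => ->.
by rewrite mulr1.
Qed.

Lemma ode_coef_high d j : (ode_coef d)`_(N.+2 + j) = 0.
Proof.
rewrite coefB !coefZ coefXM /= [X in _ * X - _]nth_default ?size_node ?leq_addr //.
by rewrite nth_default ?mulr0 ?subr0 // (leq_trans size_mass) ?leq_addr.
Qed.

(** From A = (t - z_s) A_s. The first summand does not depend on s, so it drops out under \sum_s h_s
    = 0 and leaves \sum_s z_s h_s. *)
Lemma pot_coef_lead s : (pot_coef s)`_N.+1 = (node_poly z)`_N + z s.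
Proof.
rewrite /pot_coef exprS expr1 -mulrA coefXM /= (node_polyE z s) mulrBl coefB.
by rewrite coefCM conode_lead mulr1 subrK.
Qed.

Lemma pot_coef_high s j : (pot_coef s)`_(N.+2 + j) = (j == 0)%:R.
Proof.
rewrite coefXnM ltnNge addSn addSn /= !subSS subn0.
case: j => [|j]; first by rewrite addn0 conode_lead.
by rewrite nth_default // size_conode addnS leq_addr.
Qed.

(** Terms of p below t^d can reach t^(d+N+1) only through the leading coefficients of the
    [pot_coef z s]; these do not depend on s, so \sum_s h_s = 0 removes them. *)
Lemma ode_lhs_pivot (V : lmodType F) (b : nat -> V) bh d :
  (forall d, \sum_s bh s d = 0) ->
  (forall d, \sum_s z s *: bh s d = top_weight l m *: b d) ->
  ode_lhs b bh (d + N.+1) = ode_pivot d *: b d + ode_rest b bh d.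
Proof.
move=> bh0 bhz; rewrite /ode_lhs -addSn big_split_ord /=; congr (_ + _); last first.
  by apply: eq_bigr => i _; rewrite addnS -addSn subnDl.
rewrite big_ord_recr /= [X in X + _]big1 ?add0r => [|i _]; last first.
  have -> : (d + N.+1 - i = N.+2 + (d.-1 - i))%N by have := ltn_ord i; lia.
  rewrite ode_coef_high scale0r add0r.
  by under eq_bigr do rewrite pot_coef_high; rewrite -scaler_sumr bh0 scaler0.
rewrite addKn ode_coef_lead.
under eq_bigr do rewrite pot_coef_lead scalerDl.
by rewrite big_split /= -scaler_sumr bh0 scaler0 add0r bhz -scalerDl.
Qed.

(** The second factor is the quantity in [separating] at i = l - d; the first one makes the pivot
    vanish at d = l. *)
Lemma ode_pivotE d : (d <= l)%N ->
  ode_pivot d = (l - d)%:R * (\sum_s m s - (2 * l)%:R + 1 + (l - d)%:R).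
Proof.
move=> dl; rewrite /ode_pivot /top_weight natrB // !natrM.
by case: d dl => [|d] _ /=; rewrite -?natr1; ring.
Qed.

Lemma ode_pivot_neq0 d : [pchar F] =i pred0 -> separating m l ->
  (d < l)%N -> ode_pivot d != 0.
Proof.
move=> charF0 sep_ml dl; rewrite ode_pivotE ?(ltnW dl) // mulf_neq0 //.
  by rewrite ((pcharf0P F).1 charF0) subn_eq0 -ltnNge.
by apply: sep_ml; rewrite subn_gt0 dl leq_subr.
Qed.

(** The equations at d >= l hold by themselves: at d = l the pivot is 0, above l all coefficients
    are. *)
Lemma ode_lhs_high (V : lmodType F) (b : nat -> V) bh d :
  (forall d, \sum_s bh s d = 0) ->
  (forall d, \sum_s z s *: bh s d = top_weight l m *: b d) ->
  (forall d, (l < d)%N -> b d = 0) -> (forall s d, (l < d)%N -> bh s d = 0) ->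
  (l <= d)%N -> ode_lhs b bh (d + N.+1) = 0.
Proof.
move=> bh0 bhz b_l bh_l ld; rewrite ode_lhs_pivot //.
rewrite [X in _ + X]big1 ?addr0 => [|i _]; last first.
  have ldi : (l < d.+1 + i)%N by rewrite ltnS (leq_trans ld) ?leq_addr.
  by rewrite b_l // scaler0 add0r big1 // => s _; rewrite bh_l // scaler0.
have [->|dl] := eqVneq d l; first by rewrite ode_pivotE // subnn mul0r scale0r.
by rewrite b_l ?scaler0 // ltn_neqAle eq_sym dl.
Qed.

End Recursion.

(** * Both differential equations in coefficients *)

Section CoefficientForm.
Variables (F : fieldType) (N : nat) (z m : 'I_N.+1 -> F).

Lemma ode_lhs_poly (K : comAlgType F) (p : {poly K}) (h : 'I_N.+1 -> K) e :
  ('X^2 * (map_poly (in_alg K) (node_poly z) * p^`()^`()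
           - map_poly (in_alg K) (mass_poly z m) * p^`()
           + \sum_s (h s)%:P * map_poly (in_alg K) (conode_poly z s) * p))`_e =
  ode_lhs z m (fun d => p`_d) (fun s d => h s * p`_d) e.
Proof.
set A := map_poly _ _; set B := map_poly _ (mass_poly _ _).
(* With theta = t d/dt one has t^2 p'' = theta^2 p - theta p, and theta multiplies the coefficient
   of t^d by d. *)
have -> : 'X^2 * (A * p^`()^`() - B * p^`()
      + \sum_s (h s)%:P * map_poly (in_alg K) (conode_poly z s) * p) =
    ('X * ('X * p^`())^`() - 'X * p^`()) * A - ('X * p^`()) * ('X * B)
    + \sum_s ((h s)%:P * p) * map_poly (in_alg K) (pot_coef z s).
  rewrite mulrDr mulr_sumr; congr (_ + _).
    by rewrite derivM derivX; ring.
  apply: eq_bigr => s _; rewrite rmorphM /= map_polyXn; ring.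
have XdE q d : ('X * q^`())`_d = d%:R * q`_d :> K.
  by rewrite coefXM; case: d => [|d]; rewrite /= ?mul0r // coef_deriv mulr_natl.
rewrite coefD coefB !coefM coef_sum.
under [X in _ + X = _]eq_bigr do rewrite coefM.
rewrite exchange_big /= -sumrB -big_split /=; apply: eq_bigr => d _.
congr (_ + _).
  rewrite coefB !XdE /ode_coef coefB !coefZ /A /B.
  have -> : 'X * B = map_poly (in_alg K) ('X * mass_poly z m).
    by rewrite rmorphM /= map_polyX.
  rewrite !coef_map /= !mulr_algr.
  have natE c (x : K) : c%:R * x = c%:R *: x by rewrite mulr_natl scaler_nat.
  rewrite !natE !scalerA -scalerBl !scalerA -scalerBl; congr (_ *: _).
  case: (nat_of_ord d) => [|d'] /=; first by rewrite !mul0n; ring.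
  rewrite natrM -natr1; ring.
by apply: eq_bigr => s _; rewrite coef_map coefCM /= mulr_algr.
Qed.

(** Letting only the exponent of y_k vary slices a polynomial into sequences of scalars; an equation
    in y_k alone becomes a recursion on each slice. *)
Definition set_exp (u : 'X_{1..N}) (k : 'I_N) (d : nat) : 'X_{1..N} :=
  [multinom (if j == k then d else u j) | j < N].

Lemma set_expK u k : set_exp u k (u k) = u.
Proof. by apply/mnmP => j; rewrite mnmE; case: eqP => [->|]. Qed.

Lemma set_exp_at u k d : set_exp u k d k = d.
Proof. by rewrite mnmE eqxx. Qed.

Lemma mcoeff_XM (P : {mpoly F[N]}) u k d :
  ('X_k * P)@_(set_exp u k d) = if d is d'.+1 then P@_(set_exp u k d') else 0.
Proof.
case: d => [|d].
  elim/mpolyind: P => [|c v P _ _ IHP]; first by rewrite mulr0 mcoeff0.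
  rewrite mulrDr mcoeffD IHP addr0 -scalerAr mcoeffZ -mpolyXD mcoeffX.
  case: eqP => [/mnmP/(_ k)|_]; last by rewrite mulr0.
  by rewrite mnmDE mnm1E eqxx set_exp_at.
rewrite mulrC -(mcoeffMX P U_(k)); congr (_@__); apply/mnmP => j.
by rewrite mnmDE mnm1E !mnmE eq_sym; case: eqP => _; rewrite ?addn1 ?addn0.
Qed.

Lemma mcoeff_eval_at (q : {poly F}) (P : {mpoly F[N]}) u k e :
  (eval_at k q * P)@_(set_exp u k e) =
  \sum_(d < e.+1) q`_(e - d) * P@_(set_exp u k d).
Proof.
elim/poly_ind: q P => [|q c IHq] P.
  rewrite /eval_at raddf0 mul0r mcoeff0 big1 // => d _.
  by rewrite coef0 mul0r.
rewrite /eval_at rmorphD rmorphM /= horner_algX horner_algC alg_mpolyC.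
rewrite mulrDl mcoeffD mcoeffCM -mulrA IHq big_ord_recl mcoeff_XM mulr0 add0r.
rewrite [RHS]big_ord_recr /= subnn coefD coefMX coefC /= add0r; congr (_ + _).
apply: eq_bigr => d _; rewrite mcoeff_XM /= coefD coefMX coefC.
have : (e - d)%N != 0%N by rewrite subn_eq0 -ltnNge.
by move=> /negPf ->; rewrite addr0 subnS.
Qed.

Lemma ode_lhs_mcoeff (P : {mpoly F[N]}) (Q : 'I_N.+1 -> {mpoly F[N]}) u k e :
  ('X_k ^+ 2 * (sep_oper z m k P
                + \sum_s eval_at k (conode_poly z s) * Q s))@_(set_exp u k e) =
  ode_lhs z m (fun d => P@_(set_exp u k d) : F^o)
    (fun s d => (Q s)@_(set_exp u k d) : F^o) e.
Proof.
rewrite /sep_oper.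
have -> : 'X_k ^+ 2 * (eval_at k (node_poly z) * P^`M(k)^`M(k)
        - eval_at k (mass_poly z m) * P^`M(k)
        + \sum_s eval_at k (conode_poly z s) * Q s) =
   eval_at k (node_poly z) * ('X_k * ('X_k * P^`M(k))^`M(k) - 'X_k * P^`M(k))
   - eval_at k ('X * mass_poly z m) * ('X_k * P^`M(k))
   + \sum_s eval_at k (pot_coef z s) * Q s.
  rewrite mulrDr mulr_sumr; congr (_ + _).
    rewrite mderivM mderivXU eqxx /eval_at rmorphM /= horner_algX; ring.
  apply: eq_bigr => s _.
  by rewrite /eval_at /pot_coef rmorphM rmorphXn /= horner_algX mulrA.
rewrite mcoeffD mcoeffB !mcoeff_eval_at.
rewrite [X in _ + X](_ : _ = \sum_s \sum_(d < e.+1)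
    (pot_coef z s)`_(e - d) * (Q s)@_(set_exp u k d)); last first.
  by rewrite raddf_sum; apply: eq_bigr => s _; exact: mcoeff_eval_at.
rewrite exchange_big /= -sumrB -big_split /=; apply: eq_bigr => d _.
congr (_ + _).
rewrite mcoeffB !mcoeff_mulXderiv set_exp_at /ode_coef coefB !coefZ.
set c := P@__; have scE (a : F) : a *: (c : F^o) = a * c by [].
rewrite scE -mulrnA -![c *+ _]mulr_natr natrM.
case: (nat_of_ord d) => [|d'] /=; first by rewrite !mul0n; ring.
by rewrite natrM -natr1; ring.
Qed.

End CoefficientForm.

(** * The weight function in the separated coordinates *)

Section WeightFunctionSeparated.

Lemma mcoeff_prod_horner (K : comNzRingType) N (p : {poly K}) (u : 'X_{1..N}) :
  (\prod_(k < N) (map_poly (@mpolyC N K) p).['X_k])@_u = \prod_k p`_(u k).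
Proof.
set S := size p.
have -> : \prod_(k < N) (map_poly (@mpolyC N K) p).['X_k] =
    \prod_(k < N) \sum_(d < S) (p`_d)%:MP * 'X_k ^+ d.
  apply: eq_bigr => k _; rewrite (horner_coef_wide _ (size_poly _ _)).
  by apply: eq_bigr => d _; rewrite coef_map.
rewrite bigA_distr_bigA /= raddf_sum /=.
under eq_bigr => f _.
  rewrite big_split /= -rmorph_prod /= mcoeffCM.
  rewrite (_ : \prod_i 'X_i ^+ f i = 'X_[[multinom (f i : nat) | i < N]]); last first.
    by rewrite mpolyXE_id; apply: eq_bigr => i _; rewrite mnmE.
  rewrite mcoeffX; over.
have [uS|] := boolP [forall k, (u k < S)%N]; last first.
  rewrite negb_forall => /existsP [k]; rewrite -leqNgt => ukS.
  rewrite [RHS](bigD1 k) //= nth_default // mul0r big1 // => f _.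
  case: eqP => [/mnmP/(_ k)|_]; last by rewrite mulr0.
  by rewrite mnmE => fu; move: ukS; rewrite -fu leqNgt ltn_ord.
pose f0 := [ffun k => Ordinal (forallP uS k)].
rewrite (bigD1 f0) //= [X in _ + X]big1 ?addr0 => [|f ff0].
  have -> : [multinom (f0 i : nat) | i < N] = u.
    by apply/mnmP => k; rewrite mnmE ffunE.
  by rewrite eqxx mulr1; apply: eq_bigr => k _; rewrite ffunE.
case: eqP => [/mnmP fu|_]; last by rewrite mulr0.
case/eqP: ff0; apply/ffunP => k; rewrite ffunE; apply: val_inj => /=.
by rewrite -fu mnmE.
Qed.

Lemma sum_msupp n (K : nzRingType) (V : nmodType) (p : {mpoly K[n]})
    (f : K -> 'X_{1..n} -> V) (r : seq 'X_{1..n}) :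
  (forall k, f 0 k = 0) -> uniq r -> {subset msupp p <= r} ->
  \sum_(k <- r) f p@_k k = \sum_(k <- msupp p) f p@_k k.
Proof.
move=> f0 r_uniq pr; rewrite (bigID (mem (msupp p))) /= [X in _ + X]big1 ?addr0.
  rewrite -big_filter; apply: perm_big; apply: uniq_perm => [||k].
  - exact: filter_uniq.
  - exact: msupp_uniq.
  by rewrite mem_filter andb_idr //; exact: pr.
by move=> k kp; rewrite memN_msupp_eq0.
Qed.

Variables (F : fieldType).

Lemma comp_mpoly_comp l1 l2 l3 (q : {mpoly F[l1]})
    (s : l1.-tuple {mpoly F[l2]}) (t : l2.-tuple {mpoly F[l3]}) :
  (q \mPo s) \mPo t = q \mPo [tuple tnth s i \mPo t | i < l1].
Proof.
elim/mpoly_mulX_ind: q => [c|q r IHq IHr|i q IHq].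
- by rewrite !comp_mpolyC.
- by rewrite !comp_mpolyD IHq IHr.
rewrite (rmorphM (comp_mpoly s)) (rmorphM (comp_mpoly t)) /= IHq.
rewrite [RHS](rmorphM (comp_mpoly _)); congr (_ * _).
by rewrite /= !comp_mpolyXU -!tnth_nth tnth_mktuple.
Qed.

(** Algebraic independence of the elementary symmetric polynomials, up to the signs, which form the
    involution [sg]. It lets identities in a be checked in t. *)
Lemma a_of_t_inj l (q : {mpoly F[l]}) : q \mPo a_of_t F l = 0 -> q = 0.
Proof.
pose sg : l.-tuple {mpoly F[l]} := [tuple (-1) ^+ i.+1 *: 'X_i | i < l].
have sgS : (q \mPo sg) \mPo [tuple mesym l F i.+1 | i < l] = q \mPo a_of_t F l.
  rewrite comp_mpoly_comp; congr (_ \mPo _); apply: eq_from_tnth => i.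
  by rewrite !tnth_mktuple comp_mpolyZ comp_mpolyXU -tnth_nth tnth_mktuple.
have sgK : (q \mPo sg) \mPo sg = q.
  rewrite comp_mpoly_comp -[RHS]comp_mpoly_id; congr (_ \mPo _).
  apply: eq_from_tnth => i; rewrite !tnth_mktuple comp_mpolyZ comp_mpolyXU.
  by rewrite -tnth_nth tnth_mktuple scalerA -exprD addnn -signr_odd odd_double scale1r.
by rewrite -sgS => /msym_fundamental_un0 q0; rewrite -sgK q0 comp_mpoly0.
Qed.

Lemma eq_pmonic (K : nzRingType) l (a b : 'I_l -> K) :
  a =1 b -> pmonic a = pmonic b.
Proof. by move=> ab; congr (_ + _); apply: eq_bigr => i _; rewrite ab. Qed.

Lemma map_pmonic (K K' : nzRingType) (f : {rmorphism K -> K'}) l (a : 'I_l -> K) :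
  map_poly f (pmonic a) = pmonic (f \o a).
Proof.
rewrite /pmonic rmorphD /= map_polyXn raddf_sum; congr (_ + _).
by apply: eq_bigr => i _; rewrite /= rmorphM /= map_polyC map_polyXn.
Qed.

Variables (N l : nat) (z : 'I_N.+1 -> F).
Hypothesis z_inj : injective z.

Let K := {mpoly F[l]}.
Let iota := [the {rmorphism F -> {mpoly K[N]}} of @mpolyC N K \o @mpolyC l F].
(** [sep] with scalars extended to F[t], where the coefficients of [omega_t] live. *)
Let sepK : {mpoly K[N.+1]} -> {mpoly K[N]} :=
  comp_mpoly [tuple map_mpoly (@mpolyC l F) (sep_coord z s) | s < N.+1].

(** Interpolation gives \sum_s A_s(t_j) x_s = \prod_k (y_k - t_j); both sides are the product of y_k
    - t_j over all j and k. *)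
Lemma sepK_omega_t :
  sepK (omega_t l z) =
  \prod_(k < N) (map_poly (@mpolyC N K) (pmonic (tnth (a_of_t F l)))).['X_k].
Proof.
rewrite pmonic_a_of_t /omega_t /sepK [LHS](rmorph_prod (comp_mpoly _)) /=.
transitivity (\prod_(j < l) \prod_(k < N) ('X_k - ('X_j : K)%:MP) : {mpoly K[N]}).
  apply: eq_bigr => j _.
  pose Q : {poly {mpoly K[N]}} := \prod_(k < N) (('X_k)%:P - 'X).
  have sQ : (size Q <= N.+1)%N.
    apply: leq_trans (size_poly_prod_leq _ _) _.
    rewrite (eq_bigr (fun=> 2%N)) => [|k _]; last by rewrite -opprB size_polyN size_XsubC.
    by rewrite sum_nat_const muln2 -addnn subSn ?leq_addr // addnK card_ord.
  transitivity (Q.[('X_j : K)%:MP]); last first.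
    by rewrite horner_prod; apply: eq_bigr => k _; rewrite !hornerE.
  rewrite -(lagrange_morph z_inj iota _ sQ) raddf_sum; apply: eq_bigr => s _ /=.
  rewrite linearZ /= comp_mpolyXU -tnth_nth tnth_mktuple -mul_mpolyC.
  congr (_ * _).
    rewrite rmorph_prod /= /conode_poly rmorph_prod horner_prod.
    by apply: eq_bigr => i _; rewrite !rmorphB /= map_polyX map_polyC !hornerE.
  rewrite /sep_coord map_mpolyZ -mul_mpolyC; congr (_ * _).
  rewrite rmorph_prod /= horner_prod; apply: eq_bigr => i _.
  by rewrite rmorphB /= map_mpolyX alg_mpolyC map_mpolyC !hornerE.
rewrite exchange_big; apply: eq_bigr => k _.
rewrite rmorph_prod horner_prod; apply: eq_bigr => j _ /=.
by rewrite rmorphB /= map_polyX map_polyC !hornerE.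
Qed.

Lemma sepK_X (k : 'X_{1..N.+1}) :
  sepK 'X_[k] = map_mpoly (@mpolyC l F) (sep z 'X_[k]).
Proof.
rewrite /sepK /sep !comp_mpolyX rmorph_prod; apply: eq_bigr => s _.
by rewrite /= rmorphXn /= !tnth_mktuple.
Qed.

Lemma omega_a_sep (u : 'X_{1..N}) :
  \sum_(k <- msupp (omega_a l z)) (sep z 'X_[k])@_u *: (omega_a l z)@_k =
  \prod_k (pmonic (fun i : 'I_l => 'X_i : {mpoly F[l]}))`_(u k).
Proof.
pose ev : {rmorphism K -> K} := comp_mpoly (a_of_t F l).
have evE : map_poly ev (pmonic (fun i : 'I_l => 'X_i)) = pmonic (tnth (a_of_t F l)).
  rewrite map_pmonic; apply: eq_pmonic => i.
  by rewrite /= /ev comp_mpolyXU -tnth_nth.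
apply/eqP; rewrite -subr_eq0; apply/eqP/a_of_t_inj.
apply/eqP; rewrite comp_mpolyB subr_eq0; apply/eqP.
rewrite [RHS](rmorph_prod ev) [LHS](raddf_sum ev).
transitivity (\prod_k (map_poly ev (pmonic (fun i : 'I_l => 'X_i)))`_(u k)); last first.
  by apply: eq_bigr => k _; rewrite coef_map.
rewrite evE -mcoeff_prod_horner -sepK_omega_t.
rewrite [in RHS](mpolyE (omega_t l z)) /sepK [in RHS](raddf_sum (comp_mpoly _)).
rewrite [RHS](raddf_sum (mcoeff u)).
under [LHS]eq_bigr do rewrite /= /ev comp_mpolyZ omega_aP.
under [RHS]eq_bigr do rewrite /= comp_mpolyZ mcoeffZ -/sepK sepK_X mcoeff_map_mpoly.
rewrite (sum_msupp (p := omega_t l z)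
  (f := fun c k => (sep z 'X_[k])@_u *: c)) ?msupp_uniq // => [||k].
- by apply: eq_bigr => k _; rewrite /= mulrC mul_mpolyC.
- by move=> k; rewrite scaler0.
apply: contraLR; rewrite -!mcoeff_eq0 => /eqP ak.
by rewrite -omega_aP ak comp_mpoly0.
Qed.

End WeightFunctionSeparated.

Section Pmonic.
Variables (K : nzRingType) (l : nat) (a : 'I_l -> K).

Lemma coef_pmonic_low (i : 'I_l) : (pmonic a)`_(l - i.+1) = a i.
Proof.
rewrite coefD coefXn ltn_eqF ?add0r; last by rewrite -subSn ?subSS ?ltn_ord ?leq_subr.
rewrite coef_sum (bigD1 i) //= big1 ?addr0 => [|j ji].
  by rewrite coefCM coefXn eqxx mulr1.
rewrite coefCM coefXn; case: eqP => [e|_]; last by rewrite mulr0.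
case/eqP: ji; apply: val_inj => /=.
by have := ltn_ord i; have := ltn_ord j; lia.
Qed.

Lemma coef_pmonic_lead : (pmonic a)`_l = 1.
Proof.
rewrite coefD coefXn eqxx coef_sum big1 ?addr0 // => i _.
rewrite coefCM coefXn gtn_eqF ?mulr0 //.
by have := ltn_ord i; lia.
Qed.

Lemma coef_pmonic_high d : (l < d)%N -> (pmonic a)`_d = 0.
Proof.
move=> ld; rewrite coefD coefXn gtn_eqF // coef_sum big1 ?addr0 // => i _.
rewrite coefCM coefXn gtn_eqF ?mulr0 //.
by have := ltn_ord i; lia.
Qed.

End Pmonic.

Lemma ode_lhs_linear (F : fieldType) N (z m : 'I_N.+1 -> F) (V W : lmodType F)
    (L : {linear V -> W}) b bh e :
  L (ode_lhs z m b bh e) = ode_lhs z m (L \o b) (fun s => L \o bh s) e.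
Proof.
rewrite raddf_sum; apply: eq_bigr => d _.
rewrite raddfD raddf_sum /= linearZ; congr (_ + _).
by apply: eq_bigr => s _; rewrite linearZ.
Qed.

(** * The ideal I_D and the coefficients of D_h p *)

Section Ideal.
Variables (F : fieldType) (n l : nat) (z m : 'I_n -> F).

Lemma ID_gen (f : {mpoly F[l + n]}) : f \in ID_gens l z m -> ID z m f.
Proof.
move=> /(nthP 0) [i i_lt <-]; apply/asboolP.
exists (fun j => (j == Ordinal i_lt)%:R).
rewrite (bigD1 (Ordinal i_lt)) //= eqxx mul1r big1 ?addr0 // => j /negPf ->.
by rewrite mul0r.
Qed.

Lemma ID_mull (c f : {mpoly F[l + n]}) : ID z m f -> ID z m (c * f).
Proof. by move=> If; rewrite -[c * f]subr0; apply: ID_mulB => //; exact: ID0. Qed.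

Lemma ID_q_m1 : ID z m (q_m1 F n l).
Proof. by apply: ID_gen; rewrite inE eqxx. Qed.

Lemma ID_q_0 : ID z m (q_0 l z m).
Proof. by apply: ID_gen; rewrite !inE eqxx orbT. Qed.

Lemma ID_q i : (0 < i <= l + n - 2)%N -> ID z m (q_ l z m i).
Proof.
case/andP=> i_gt0 i_le; apply: ID_gen; rewrite !inE; apply/orP; right; apply/orP; right.
by apply/mapP; exists i; rewrite // mem_iota i_gt0 add1n ltnS.
Qed.

Definition piAD_lin : {mpoly F[l + n]} -> AD l z m := piAD z m.
HB.instance Definition _ :=
  GRing.isLinear.Build F {mpoly F[l + n]} (AD l z m) _ piAD_lin
    (@piAD_linear F n l z m).

Lemma piAD_eq0 f : ID z m f -> piAD_lin f = 0.
Proof.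
by move=> If; rewrite -(raddf0 piAD_lin); apply/piAD_eq; rewrite subr0.
Qed.

End Ideal.

Section IdealCoefficients.
Variables (F : fieldType) (N l : nat) (z m : 'I_N.+1 -> F).
Local Notation n := N.+1.
Local Notation R := {mpoly F[l + n]}.
Local Notation p := (pxa F n l).

Lemma ode_lhs_Dh e :
  ('X^2 * Dh z m p)`_e =
  ode_lhs z m (fun d => p`_d) (fun s d => hvar F l s * p`_d) e.
Proof.
rewrite -ode_lhs_poly; apply: (congr1 (fun q : {poly R} => ('X^2 * q)`_e)); rewrite /Dh.
have conodeE s : map_poly (in_alg R) (conode_poly z s) =
    \prod_(r < n | r != s) xz l z r.
  rewrite /conode_poly rmorph_prod; apply: eq_bigr => r _ /=.
  by rewrite rmorphB /= map_polyX map_polyC /= alg_mpolyC.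
have nodeE : map_poly (in_alg R) (node_poly z) = \prod_(r < n) xz l z r.
  rewrite /node_poly rmorph_prod; apply: eq_bigr => r _ /=.
  by rewrite rmorphB /= map_polyX map_polyC /= alg_mpolyC.
have massE : map_poly (in_alg R) (mass_poly z m) =
    \sum_(s < n) ((m s)%:MP)%:P * \prod_(r < n | r != s) xz l z r.
  rewrite /mass_poly raddf_sum; apply: eq_bigr => s _ /=.
  by rewrite map_polyZ /= alg_mpolyC -mul_polyC conodeE.
have potE : (\sum_(s < n) (hvar F l s)%:P * \prod_(r < n | r != s) xz l z r) * p =
    \sum_(s < n) (hvar F l s)%:P * map_poly (in_alg R) (conode_poly z s) * p.
  by rewrite mulr_suml; apply: eq_bigr => s _; rewrite conodeE.
by rewrite nodeE massE; exact: (congr1 (fun q => _ + q) potE).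
Qed.

(** The coefficients from t^2 to t^(l+n-1) are the generators [q_ l z m i], the two below are 0, and
    those above vanish modulo q_{-1} and q_0 by [ode_lhs_high]. *)
Lemma ID_ode e : ID z m ('X^2 * Dh z m p)`_e.
Proof.
have [le|el] := leqP (l + n)%N e.
  have -> : e = ((e - n) + N.+1)%N by rewrite subnK // (leq_trans _ le) // leq_addl.
  rewrite ode_lhs_Dh -[ode_lhs _ _ _ _ _]subr0.
  have H : piAD_lin z m (ode_lhs z m (fun d => p`_d)
             (fun s d => hvar F l s * p`_d) (e - n + N.+1)) = 0.
    rewrite ode_lhs_linear.
    apply: (ode_lhs_high (l := l)) => [d|d|d ld|s d ld|] /=.
    - rewrite -(raddf_sum (piAD_lin z m)) -mulr_suml mulrC.
      exact/piAD_eq0/ID_mull/ID_q_m1.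
    - transitivity (piAD_lin z m ((\sum_s z s *: hvar F l s) * p`_d)).
        rewrite mulr_suml [RHS](raddf_sum (piAD_lin z m)).
        by apply: eq_bigr => s _; rewrite -scalerAl [RHS]linearZ.
      have -> : top_weight l m *: piAD_lin z m p`_d =
          piAD_lin z m (top_weight l m *: p`_d) by rewrite linearZ.
      apply/eqP; rewrite -subr_eq0 -(raddfB (piAD_lin z m)); apply/eqP/piAD_eq0.
      rewrite -mul_mpolyC -mulrBl mulrC; apply: ID_mull.
      exact: ID_q_0.
    - by rewrite coef_pmonic_high ?raddf0.
    - by rewrite coef_pmonic_high ?mulr0 ?raddf0.
    by rewrite leq_subRL ?(leq_trans _ le) ?leq_addl // addnC.
  by apply/piAD_eq; rewrite -[LHS]/(piAD_lin z m _) H; exact/esym/(raddf0 (piAD_lin z m)).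
rewrite coefXnM; case: ltnP => [_|e2]; first exact: ID0.
have -> : (e - 2 = l + n - 2 - (l + n - e))%N by lia.
by apply: ID_q; lia.
Qed.

End IdealCoefficients.

Lemma mcoeff_sumX (K : nzRingType) n (r : seq 'X_{1..n}) (c : 'X_{1..n} -> K) k :
  uniq r -> (\sum_(j <- r) c j *: 'X_[j] : {mpoly K[n]})@_k = if k \in r then c k else 0.
Proof.
move=> r_uniq; rewrite raddf_sum /=.
under eq_bigr do rewrite mcoeffZ mcoeffX.
case: ifPn => kr.
  rewrite (bigD1_seq k) //= eqxx mulr1 big1 ?addr0 // => j /negPf ->.
  by rewrite mulr0.
rewrite big1_seq // => j /= jr.
by case: eqP jr kr => [->|_]; rewrite ?mulr0 // => ->.
Qed.

(** * Functionals on F[a, h] and the lift of tau to them *)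

Section Functionals.
Variables (F : fieldType) (n l : nat) (z m : 'I_n -> F).
Local Notation R := {mpoly F[l + n]}.
Implicit Types (G : {scalar R}) (f : R).

(** The dual of multiplication by f; it stands in for the action of A_D on its dual space. *)
Definition mul_functional f G (r : R) : F := G (f * r).

Fact mul_functional_is_scalar f G : scalar (mul_functional f G).
Proof. by move=> c a b; rewrite /mul_functional mulrDr -scalerAr linearP. Qed.
HB.instance Definition _ f G :=
  GRing.isLinear.Build F R F _ (mul_functional f G)
    (mul_functional_is_scalar f G).

Definition a_to_Fah (q : {mpoly F[l]}) : R := q \mPo [tuple avar F n i | i < l].

Definition tau_lift G : {mpoly F[n]} :=
  \sum_(k <- msupp (omega_a l z)) G (a_to_Fah (omega_a l z)@_k) *: 'X_[k].

Lemma mcoeff_tau_lift G k :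
  (tau_lift G)@_k = G (a_to_Fah (omega_a l z)@_k).
Proof.
rewrite mcoeff_sumX ?msupp_uniq //; case: ifPn => // /memN_msupp_eq0 ->.
by rewrite /a_to_Fah comp_mpoly0 raddf0.
Qed.

Definition kills_ID G := forall r, ID z m r -> G r = 0.

Lemma kills_ID_mul f G : kills_ID G -> kills_ID (mul_functional f G).
Proof. by move=> GI r Ir; apply/GI/ID_mull. Qed.

Lemma tau_liftE (g : {scalar AD l z m}) G :
  (forall r, G r = g (piAD z m r)) -> tau g = tau_lift G.
Proof.
move=> GE; apply/mpolyP => k; rewrite mcoeff_tau_lift GE /tau /contract.
rewrite mcoeff_sumX ?fset_uniq // -/(a_to_AD z m _) -omega_DE.
by case: ifPn => // kS; rewrite fsfun_dflt // raddf0.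
Qed.

Lemma omega_a_homog k : mdeg k != l -> (omega_a l z)@_k = 0.
Proof.
have /dhomog_nemf_coeff h : omega_t l z \is l.-homog.
  rewrite /omega_t -[X in X.-homog](_ : (\sum_(j < l) 1)%N = l); last first.
    by rewrite sum_nat_const card_ord muln1.
  elim/big_rec2: _ => [|j d P _ hP]; first exact: dhomog1.
  apply: dhomogM => //; apply: rpred_sum => s _; apply: rpredZ.
  by rewrite dhomogX; apply/eqP; exact: mdeg1.
by move=> kl; apply: a_of_t_inj; rewrite omega_aP h.
Qed.

Lemma hom_tau_lift G : [pchar F] =i pred0 -> hom_deg l%:R (tau_lift G).
Proof.
move=> charF0; apply/(hom_degP charF0) => k kl.
by rewrite mcoeff_tau_lift omega_a_homog // /a_to_Fah comp_mpoly0 raddf0.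
Qed.

Lemma eq_tau_lift G1 G2 : G1 =1 G2 -> tau_lift G1 = tau_lift G2.
Proof. by move=> eG; apply: eq_bigr => k _; rewrite eG. Qed.

End Functionals.

Lemma ode_lhs_scalar (F : fieldType) N (z m : 'I_N.+1 -> F) (V : lmodType F)
    (L : {scalar V}) b bh e :
  L (ode_lhs z m b bh e) =
  ode_lhs z m (fun d => L (b d) : F^o) (fun s d => L (bh s d) : F^o) e.
Proof.
rewrite (raddf_sum L); apply: eq_bigr => d _.
rewrite (raddfD L) (raddf_sum L) /= scalarZ; congr (_ + _).
by apply: eq_bigr => s _; rewrite scalarZ.
Qed.

(** * tau intertwines h_s with H_s; injectivity *)

Section Intertwining.
Variables (F : fieldType) (N l : nat) (z m : 'I_N.+1 -> F).
Hypothesis z_inj : injective z.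
Hypothesis charF0 : [pchar F] =i pred0.
Local Notation R := {mpoly F[l + N.+1]}.
Local Notation p := (pxa F N.+1 l).
Local Notation hv := (hvar F l).
Implicit Types (G : {scalar R}) (f : R).

Lemma a_to_Fah_pmonic d :
  a_to_Fah N.+1 (pmonic (fun i : 'I_l => 'X_i : {mpoly F[l]}))`_d = p`_d.
Proof.
rewrite /a_to_Fah -(coef_map (comp_mpoly _)) /= map_pmonic.
apply: (congr1 (fun q : {poly R} => q`_d)); apply: eq_pmonic => i.
by rewrite /= comp_mpolyXU -tnth_nth tnth_mktuple.
Qed.

(** The coefficientwise form of \prod_k p(y_k), through which [tau_lift] is computed from here
    on. *)
Lemma mcoeff_sep_tau_lift G u :
  (sep z (tau_lift z G))@_u = G (\prod_k p`_(u k)).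
Proof.
rewrite /tau_lift (raddf_sum (sep z)) (raddf_sum (mcoeff u)).
under [in RHS]eq_bigr do rewrite -a_to_Fah_pmonic.
rewrite -(rmorph_prod (comp_mpoly [tuple avar F N.+1 i | i < l])).
rewrite -(omega_a_sep l z_inj) [in RHS]/= (raddf_sum (comp_mpoly _)) (raddf_sum G).
apply: eq_bigr => k _.
by rewrite /= linearZ mcoeffZ comp_mpolyZ linearZ /= mulrC.
Qed.

(** On a slice along y_k the other variables contribute a constant factor [c], so each coefficient
    is G at [c] times a coefficient of t^2 D_h p, an element of I_D. *)
Lemma tau_lift_ode G k : kills_ID z m G ->
  sep_oper z m k (sep z (tau_lift z G))
  + \sum_s eval_at k (conode_poly z s)
           * sep z (tau_lift z (mul_functional (hv s) G)) = 0.
Proof.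
move=> GI; have Xk0 : 'X_k ^+ 2 != 0 :> {mpoly F[N]}.
  rewrite expf_neq0 //; apply/eqP => /(congr1 (mcoeff U_(k))) /eqP.
  by rewrite mcoeffXU eqxx mcoeff0 oner_eq0.
apply/eqP; rewrite -(mulrI_eq0 _ (mulfI Xk0)); apply/eqP/mpolyP => u.
rewrite -(set_expK u k) ode_lhs_mcoeff mcoeff0.
pose c := \prod_(j < N | j != k) p`_(u j).
have prodE d : \prod_j p`_(set_exp u k d j) = c * p`_d.
  rewrite (bigD1 k) //= set_exp_at mulrC; congr (_ * _).
  by apply: eq_bigr => j jk; rewrite mnmE (negPf jk).
rewrite -[RHS](kills_ID_mul c GI (ID_ode l z m (u k))) ode_lhs_Dh.
rewrite ode_lhs_scalar.
apply: eq_bigr => d _; rewrite mcoeff_sep_tau_lift prodE; congr (_ + _).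
apply: eq_bigr => s _; rewrite mcoeff_sep_tau_lift prodE.
by rewrite /= /mul_functional mulrCA.
Qed.

Lemma tau_liftD f1 f2 G :
  tau_lift z (mul_functional (f1 + f2) G) =
  tau_lift z (mul_functional f1 G) + tau_lift z (mul_functional f2 G).
Proof.
rewrite /tau_lift -big_split; apply: eq_bigr => k _.
by rewrite /= /mul_functional mulrDl raddfD scalerDl.
Qed.

Lemma tau_liftZ c f G :
  tau_lift z (mul_functional (c *: f) G) = c *: tau_lift z (mul_functional f G).
Proof.
rewrite /tau_lift scaler_sumr; apply: eq_bigr => k _.
by rewrite /= /mul_functional -scalerAl linearZ scalerA.
Qed.

Lemma tau_lift0 G : tau_lift z (mul_functional 0 G) = 0.
Proof. by rewrite -[0](scale0r 0) tau_liftZ scale0r. Qed.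

Lemma tau_lift_sum I (r : seq I) (f : I -> R) G :
  tau_lift z (mul_functional (\sum_(i <- r) f i) G) =
  \sum_(i <- r) tau_lift z (mul_functional (f i) G).
Proof.
elim: r => [|i r IHr]; first by rewrite !big_nil tau_lift0.
by rewrite !big_cons tau_liftD IHr.
Qed.

Lemma tau_lift_kill f G : kills_ID z m G -> ID z m f ->
  tau_lift z (mul_functional f G) = 0.
Proof.
move=> GI If; rewrite -(tau_lift0 G); apply: eq_tau_lift => r.
by rewrite /= /mul_functional mul0r raddf0 mulrC GI //; exact: ID_mull.
Qed.

(** Both families, indexed by s, sum to 0 and solve the same equation in every y_k; their difference
    vanishes by interpolation and [sep_inj]. *)
Lemma gaudin_tau_lift s G : kills_ID z m G ->
  gaudin z m s (tau_lift z G) = tau_lift z (mul_functional (hv s) G).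
Proof.
move=> GI; apply/eqP; rewrite -subr_eq0; apply/eqP.
have hT G' := hom_tau_lift z G' charF0.
apply: (sep_inj z_inj charF0 (d := l)).
  by apply: hom_degB => //; exact: hom_deg_gaudin.
move: s; apply: (eval_at_interpolation z_inj) => [|k].
  rewrite -(raddf_sum (sep z)) sumrB sum_gaudin -tau_lift_sum.
  by rewrite (tau_lift_kill GI (ID_q_m1 _ _ _)) subr0 raddf0.
under eq_bigr do rewrite (raddfB (sep z)) mulrBr.
rewrite sumrB.
have /eqP := separation m z_inj k (tau_lift z G).
rewrite addr_eq0 => /eqP e1; have /eqP := tau_lift_ode k GI.
by rewrite e1 addrC subr_eq0 => /eqP ->; rewrite subrr.
Qed.

Lemma in_sing_tau_lift G : kills_ID z m G -> in_sing l z m (tau_lift z G).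
Proof.
move=> GI; split; first exact: hom_tau_lift.
under eq_bigr do rewrite gaudin_tau_lift // -tau_liftZ.
rewrite -tau_lift_sum; apply/eqP; rewrite -subr_eq0; apply/eqP.
rewrite -(tau_lift_kill GI (ID_q_0 _ _ _)) tau_liftD; congr (_ + _).
rewrite -scaleNr -mpolyCN -[_%:MP]mulr1 mul_mpolyC tau_liftZ; congr (_ *: _).
by apply: eq_tau_lift => r; rewrite /= /mul_functional mul1r.
Qed.

Hypothesis m_sep : separating m l.

(** Descending induction from the leading coefficient 1: the coefficient of t^(d+N+1) in t^2 D_h p
    leaves a nonzero pivot times the vector for d plus terms with larger index, which vanish
    together with their images under the H_s. *)
Lemma tau_lift_coef_eq0 G d : kills_ID z m G -> tau_lift z G = 0 ->
  tau_lift z (mul_functional p`_d G) = 0.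
Proof.
move=> GI G0.
suff H i : forall d, (l <= d + i)%N -> tau_lift z (mul_functional p`_d G) = 0.
  by apply: (H l); rewrite leq_addl.
elim: i => [|i IHi] {}d.
  rewrite addn0 leq_eqVlt => /orP [/eqP <-|ld].
    rewrite -G0; apply: eq_tau_lift => r.
    by rewrite /= /mul_functional coef_pmonic_lead mul1r.
  by rewrite coef_pmonic_high // tau_lift0.
have [ld _|dl ldi] := leqP l d.
  by apply: IHi; rewrite (leq_trans ld) ?leq_addr.
pose b e := tau_lift z (mul_functional p`_e G).
pose bh s e := tau_lift z (mul_functional (hv s * p`_e) G).
have bhE s e : bh s e = gaudin z m s (b e).
  rewrite gaudin_tau_lift; last exact: kills_ID_mul.
  by apply: eq_tau_lift => r; rewrite /= /mul_functional mulrA [p`__ * _]mulrC.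
have : ode_lhs z m b bh (d + N.+1) = 0.
  have E : tau_lift z (mul_functional ('X^2 * Dh z m p)`_(d + N.+1) G) = 0.
    exact/(tau_lift_kill GI)/ID_ode.
  rewrite -[RHS]E ode_lhs_Dh /ode_lhs tau_lift_sum; apply: eq_bigr => e _.
  rewrite tau_liftD tau_liftZ tau_lift_sum; congr (_ + _).
  by apply: eq_bigr => s _; rewrite tau_liftZ.
rewrite (ode_lhs_pivot (l := l)) => [|e|e].
- have b0 j : b (d.+1 + j)%N = 0.
    by apply: IHi; lia.
  rewrite [X in _ + X](_ : _ = 0) ?addr0.
    move=> /eqP; rewrite scaler_eq0 => /orP [|/eqP //].
    by rewrite (negPf (ode_pivot_neq0 _ _ _)).
  rewrite /ode_rest big1 // => j _; rewrite b0 scaler0 add0r big1 // => s _.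
  by rewrite bhE b0 raddf0 scaler0.
- by under eq_bigr do rewrite bhE; rewrite sum_gaudin.
under eq_bigr do rewrite bhE.
by have [_ ->] := in_sing_tau_lift (kills_ID_mul p`_e GI).
Qed.

(** Multiplying the functional by any variable keeps its image 0: an h_s acts as H_s, and an a_i is
    a coefficient of p. *)
Lemma tau_lift_inj G : kills_ID z m G -> tau_lift z G = 0 -> forall f, G f = 0.
Proof.
move=> GI G0 f.
suff : tau_lift z (mul_functional f G) = 0.
  move=> /(congr1 (sep z)) /(congr1 (mcoeff [multinom l | _ < N])).
  rewrite mcoeff_sep_tau_lift (raddf0 (sep z)) mcoeff0 big1 => [|k _].
    by rewrite /= /mul_functional mulr1.
  by rewrite mnmE coef_pmonic_lead.
have mulE f1 f2 : tau_lift z (mul_functional (f1 * f2) G) =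
    tau_lift z (mul_functional f1 (mul_functional f2 G)).
  by apply: eq_tau_lift => r; rewrite /= /mul_functional mulrA [f2 * f1]mulrC.
elim/mpoly_mulX_ind: f => [c|f g f0 g0|i f f0].
- rewrite -[c%:MP]mulr1 mul_mpolyC tau_liftZ.
  by rewrite -[RHS](scaler0 _ c) -G0; congr (_ *: _); apply: eq_tau_lift => r;
    rewrite /= /mul_functional mul1r.
- by rewrite tau_liftD f0 g0 addr0.
rewrite mulE; have fI := kills_ID_mul f GI.
case: (split_ordP i) => [j ->|s ->].
  have -> : 'X_(lshift N.+1 j) = p`_(l - j.+1) by rewrite coef_pmonic_low.
  exact: tau_lift_coef_eq0.
by rewrite -/(hv s) -gaudin_tau_lift // f0 raddf0.
Qed.

End Intertwining.

(** * Polynomials in operators that commute on an invariant subspace *)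

Section CommutingAction.
Variables (F : fieldType) (n : nat) (V : lmodType F) (S : V -> Prop).
Variable (O : 'I_n -> {linear V -> V}).
Hypothesis S0 : S 0.
Hypothesis SD : forall v w, S v -> S w -> S (v + w).
Hypothesis SZ : forall c v, S v -> S (c *: v).
Hypothesis SO : forall i v, S v -> S (O i v).
Hypothesis OC : forall i j v, S v -> O i (O j v) = O j (O i v).

Definition mon_act (k : 'X_{1..n}) (r : seq 'I_n) (v : V) : V :=
  foldr (fun i => iter (k i) (O i)) v r.

(** Monomials act in the fixed order of [enum 'I_n], so linearity in q holds for every v; products
    are respected on S, where the operators commute. *)
Definition poly_act (v : V) (q : {mpoly F[n]}) : V :=
  \sum_(k <- msupp q) q@_k *: mon_act k (enum 'I_n) v.

Lemma iter_act_S i d v : S v -> S (iter d (O i) v).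
Proof. by move=> Sv; elim: d => //= d IHd; exact: SO. Qed.

Lemma mon_act_S k r v : S v -> S (mon_act k r v).
Proof. by move=> Sv; elim: r => //= i r IHr; exact: iter_act_S. Qed.

Lemma mon_act_U k i r v : S v -> uniq r ->
  mon_act (U_(i) + k) r v =
  if i \in r then O i (mon_act k r v) else mon_act k r v.
Proof.
move=> Sv; elim: r => //= j r IHr /andP [jr r_uniq].
rewrite IHr // inE mnmDE mnm1E; have [->|ij] /= := eqVneq i j.
  by rewrite (negPf jr).
case: ifP => // _; rewrite add0n; elim: (k j) => //= d ->.
by rewrite OC //; apply/iter_act_S/mon_act_S.
Qed.

Lemma poly_act_widen q v r : uniq r -> {subset msupp q <= r} ->
  poly_act v q = \sum_(k <- r) q@_k *: mon_act k (enum 'I_n) v.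
Proof.
move=> r_uniq qr; rewrite (sum_msupp (f := fun c k => c *: mon_act k _ v)) //.
by move=> k; rewrite scale0r.
Qed.

Fact poly_act_is_linear v : linear (poly_act v).
Proof.
move=> c p q; pose r := undup (msupp p ++ msupp q ++ msupp (c *: p + q)).
have r_uniq : uniq r by exact: undup_uniq.
have pr : {subset msupp p <= r} by move=> k kp; rewrite mem_undup !mem_cat kp.
have qr : {subset msupp q <= r}.
  by move=> k kq; rewrite mem_undup !mem_cat kq orbT.
have cr : {subset msupp (c *: p + q) <= r}.
  by move=> k kc; rewrite mem_undup !mem_cat kc !orbT.
rewrite (poly_act_widen v r_uniq cr) (poly_act_widen v r_uniq pr).
rewrite (poly_act_widen v r_uniq qr).
rewrite scaler_sumr -big_split; apply: eq_bigr => k _ /=.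
by rewrite mcoeffD mcoeffZ scalerDl scalerA.
Qed.

HB.instance Definition _ v :=
  GRing.isLinear.Build F {mpoly F[n]} V _ (poly_act v) (poly_act_is_linear v).

Lemma poly_actD p q v : poly_act v (p + q) = poly_act v p + poly_act v q.
Proof. exact: (raddfD (poly_act v)). Qed.

Lemma poly_actZ c q v : poly_act v (c *: q) = c *: poly_act v q.
Proof. by rewrite linearZ. Qed.

Lemma poly_actX k v : poly_act v 'X_[k] = mon_act k (enum 'I_n) v.
Proof. by rewrite /poly_act msuppX big_seq1 mcoeffX eqxx scale1r. Qed.

Lemma poly_actC c v : poly_act v c%:MP = c *: v.
Proof.
rewrite -[c%:MP]mulr1 mul_mpolyC poly_actZ /= -mpolyX0 poly_actX.
congr (_ *: _); elim: (enum _) => //= i r ->.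
by rewrite mnm0E.
Qed.

Lemma poly_act_S q v : S v -> S (poly_act v q).
Proof.
move=> Sv; rewrite /poly_act; elim: (msupp q) => [|k r IHr].
  by rewrite big_nil.
by rewrite big_cons; apply: SD => //; apply/SZ/mon_act_S.
Qed.

Lemma poly_act_mulX i q v : S v -> poly_act v ('X_i * q) = O i (poly_act v q).
Proof.
move=> Sv; elim/mpolyind: q => [|c k q _ _ IHq].
  by rewrite mulr0 ![poly_act v 0](raddf0 (poly_act v)) raddf0.
rewrite mulrDr !poly_actD IHq (raddfD (O i)); congr (_ + _).
rewrite -scalerAr !poly_actZ.
rewrite [RHS](_ : _ = c *: O i (poly_act v 'X_[k])); last exact: linearZ.
congr (_ *: _); rewrite -mpolyXD !poly_actX mon_act_U ?enum_uniq //.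
by rewrite mem_enum.
Qed.

Lemma poly_actM p q v : S v -> poly_act v (p * q) = poly_act (poly_act v q) p.
Proof.
move=> Sv; elim/mpoly_mulX_ind: p => [c|p r IHp IHr|i p IHp].
- by rewrite mul_mpolyC poly_actC poly_actZ.
- by rewrite mulrDl !poly_actD IHp IHr.
by rewrite -mulrA !poly_act_mulX ?IHp //; exact: poly_act_S.
Qed.

End CommutingAction.

(** [approx i] is already final at every d >= l - i, so [approx l] is final everywhere. *)
Lemma descending_rec (T : Type) (l : nat) (base : nat -> T)
    (step : nat -> (nat -> T) -> T) :
  (forall d f g, (forall e, (d < e)%N -> f e = g e) -> step d f = step d g) ->
  exists f, forall d, f d = if (d < l)%N then step d f else base d.
Proof.
move=> step_ext.
pose fix approx i := if i is i'.+1 then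
  fun d => if (d < l)%N then step d (approx i') else base d else base.
have stable i j d : (l <= d + i)%N -> (i <= j)%N -> approx j d = approx i d.
  elim: i j d => [|i IHi] [|j] d //= ldi ij.
    by rewrite ltnNge -[d]addn0 ldi.
  case: ifP => // dl; apply: step_ext => e de.
  by apply: IHi => //; lia.
exists (approx l) => d; rewrite -(stable l l.+1) ?leq_addl //=.
Qed.

Section DegreeBound.
Variables (F : fieldType) (N : nat) (k : 'I_N).

Definition deg_le (b : nat) (P : {mpoly F[N]}) :=
  forall w : 'X_{1..N}, (b < w k)%N -> P@_w = 0.

Lemma deg_leM b c P Q : deg_le b P -> deg_le c Q -> deg_le (b + c) (P * Q).
Proof.
move=> bP cQ w bcw; rewrite mcoeffM big1 // => -[w1 w2] /= /eqP ww.
have [w1b|bw1] := leqP (w1 k) b; last by rewrite bP ?mul0r.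
have [w2c|cw2] := leqP (w2 k) c; last by rewrite cQ ?mulr0.
have := leq_add w1b w2c; rewrite -mnmDE -ww leqNgt.
by rewrite bcw.
Qed.

Lemma deg_leC c : deg_le 0 c%:MP.
Proof.
move=> w w0; rewrite mcoeffC; case: eqP => [ww|_]; last by rewrite mulr0.
by move: w0; rewrite ww mnm0E.
Qed.

Lemma deg_le_sep_coord (z : 'I_N.+1 -> F) s : deg_le 1 (sep_coord z s).
Proof.
rewrite (sep_coordE z k) -[1%N]addn0; apply: deg_leM.
  move=> w w1; rewrite alg_mpolyC mcoeffB deg_leC ?(ltn_trans _ w1) // subr0.
  rewrite mcoeffX; case: eqP => // ww; move: w1.
  by rewrite -ww mnm1E eqxx.
rewrite /sep_weight -mul_mpolyC -[0%N]addn0; apply: deg_leM; first exact: deg_leC.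
apply: (big_ind (deg_le 0)) => [|P Q P0 Q0|j jk]; first exact: deg_leC.
  by rewrite -[0%N]addn0; exact: deg_leM.
move=> w w1; rewrite alg_mpolyC mcoeffB deg_leC // subr0 mcoeffX.
by case: eqP => // ww; move: w1; rewrite -ww mnm1E (negPf jk).
Qed.

(** Each x_s is of degree at most 1 in y_k. The bound provides the start of the descending recursion
    on slices. *)
Lemma deg_le_sep (z : 'I_N.+1 -> F) l f : [pchar F] =i pred0 ->
  hom_deg l%:R f -> deg_le l (sep z f).
Proof.
move=> charF0 /(hom_degP charF0) hf w lw.
rewrite (mpolyE f) (raddf_sum (sep z)) raddf_sum big1 // => e0 _ /=.
rewrite linearZ mcoeffZ.
have [kl|/hf ->] := eqVneq (mdeg e0) l; last by rewrite mul0r.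
suff /(_ w) -> : deg_le l (sep z 'X_[e0]) by rewrite ?mulr0.
rewrite mpolyXE_id rmorph_prod -kl mdegE.
elim/big_rec2: _ => [|s d P _ hP]; first exact: deg_leC.
rewrite addnC mulrC; apply: deg_leM => //=.
rewrite rmorphXn /= sepX; elim: (e0 s) => [|e IHe]; first exact: deg_leC.
by rewrite exprS -add1n; apply: deg_leM => //; exact: deg_le_sep_coord.
Qed.

End DegreeBound.

Lemma eq_ode_lhs (F : fieldType) N (z m : 'I_N.+1 -> F) (V : lmodType F)
    (b b' : nat -> V) (bh bh' : 'I_N.+1 -> nat -> V) e :
  b =1 b' -> (forall s, bh s =1 bh' s) -> ode_lhs z m b bh e = ode_lhs z m b' bh' e.
Proof.
move=> bb' bhh'; apply: eq_bigr => d _; rewrite bb'; congr (_ + _).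
by apply: eq_bigr => s _; rewrite bhh'.
Qed.

Lemma ode_rest_scalar (F : fieldType) N (z m : 'I_N.+1 -> F) (V : lmodType F)
    (L : {scalar V}) b bh d :
  L (ode_rest z m b bh d) =
  ode_rest z m (fun d => L (b d) : F^o) (fun s d => L (bh s d) : F^o) d.
Proof.
rewrite (raddf_sum L); apply: eq_bigr => i _.
rewrite (raddfD L) (raddf_sum L) /= scalarZ; congr (_ + _).
by apply: eq_bigr => s _; rewrite scalarZ.
Qed.

(** * The action of F[a, h] on singular vectors; surjectivity *)

Section Surjectivity.
Variables (F : fieldType) (N l : nat) (z m : 'I_N.+1 -> F).
Hypothesis z_inj : injective z.
Hypothesis charF0 : [pchar F] =i pred0.
Hypothesis m_sep : separating m l.
Local Notation R := {mpoly F[l + N.+1]}.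
Local Notation Hr := {mpoly F[N.+1]}.
Local Notation p := (pxa F N.+1 l).
Local Notation Sing := (in_sing l z m).
Implicit Types (v : {mpoly F[N.+1]}) (q : Hr) (u : 'X_{1..N}) (k : 'I_N).

Definition gaudin_act v q : {mpoly F[N.+1]} :=
  poly_act (fun s => gaudin z m s : {linear {mpoly F[N.+1]} -> {mpoly F[N.+1]}}) v q.

Lemma gaudin_act_is_linear v : linear (gaudin_act v).
Proof. exact: poly_act_is_linear. Qed.
HB.instance Definition _ v :=
  GRing.isLinear.Build F Hr {mpoly F[N.+1]} _ (gaudin_act v)
    (gaudin_act_is_linear v).

Lemma Sing0 : Sing 0.
Proof.
split; first by rewrite /hom_deg raddf0 scaler0.
by rewrite scaler0 big1 // => s _; rewrite raddf0 scaler0.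
Qed.

Lemma gaudin_Sing s v : Sing v -> Sing (gaudin z m s v).
Proof. exact: in_sing_gaudin. Qed.

Lemma gaudin_SingC s t v : Sing v ->
  gaudin z m s (gaudin z m t v) = gaudin z m t (gaudin z m s v).
Proof. by case=> hv _; exact: (gaudinC m z_inj charF0 hv). Qed.

Lemma gaudin_act_Sing q v : Sing v -> Sing (gaudin_act v q).
Proof.
apply: poly_act_S; [exact: Sing0|exact: in_singD|exact: in_singZ|exact: gaudin_Sing].
Qed.

Lemma gaudin_actM q r v : Sing v ->
  gaudin_act v (q * r) = gaudin_act (gaudin_act v r) q.
Proof.
apply: (poly_actM (S := Sing)); by [exact: Sing0|exact: in_singD|exact: in_singZ
  |exact: gaudin_Sing|exact: gaudin_SingC].
Qed.

Lemma gaudin_actX s v : Sing v -> gaudin_act v 'X_s = gaudin z m s v.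
Proof.
move=> Sv; rewrite -[X in gaudin_act v X]mulr1.
apply: etrans (poly_act_mulX gaudin_Sing gaudin_SingC s 1 Sv) _.
by rewrite /= -mpolyC1 poly_actC scale1r.
Qed.

(** The pivot equation solved for its lowest coefficient, in the free ring F[h]; the relations on
    \sum_s h_s and \sum_s z_s h_s enter only after acting on singular vectors. *)
Lemma alpha_exists : exists alpha : nat -> Hr, forall d,
  alpha d = if (d < l)%N
    then - (ode_pivot l m d)^-1 *: ode_rest z m alpha (fun s e => 'X_s * alpha e) d
    else (d == l)%:R.
Proof.
apply: (@descending_rec Hr l (fun d => (d == l)%:R)
  (fun d al => - (ode_pivot l m d)^-1
     *: ode_rest z m al (fun s e => 'X_s * al e) d)) => d f g fg.
congr (_ *: _); apply: eq_bigr => i _.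
have di : (d < d.+1 + i)%N by rewrite ltnS leq_addr.
by rewrite (fg _ di); congr (_ + _); apply: eq_bigr => s _; rewrite (fg _ di).
Qed.

(* The coefficient of t^d in the polynomial p, as a polynomial in the h_s. *)
Definition alpha : nat -> Hr := projT1 (cid alpha_exists).

Lemma alpha_lt d : (d < l)%N ->
  ode_pivot l m d *: alpha d
  + ode_rest z m alpha (fun s e => 'X_s * alpha e) d = 0.
Proof.
move=> dl; rewrite /alpha; case: cid => al /= alE.
rewrite {1}alE dl scalerA mulrN divff ?ode_pivot_neq0 // scaleN1r.
by rewrite addNr.
Qed.

Lemma alpha_l : alpha l = 1.
Proof. by rewrite /alpha; case: cid => al /= ->; rewrite ltnn eqxx. Qed.

Lemma alpha_gt d : (l < d)%N -> alpha d = 0.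
Proof.
by move=> ld; rewrite /alpha; case: cid => al /= ->; rewrite ltnNge ltnW // gtn_eqF.
Qed.

(** Eliminating a leaves only the h_s, which act as the H_s; this is how F[a, h] acts on singular
    vectors. *)
Definition elim_a : R -> Hr :=
  comp_mpoly [tuple match split i with
                    | inl j => alpha (l - j.+1)
                    | inr s => 'X_s
                    end | i < l + N.+1].
HB.instance Definition _ := GRing.RMorphism.copy elim_a
  (comp_mpoly [tuple match split i with
                    | inl j => alpha (l - j.+1)
                    | inr s => 'X_s
                    end | i < l + N.+1]).
HB.instance Definition _ := GRing.Linear.copy elim_a
  (comp_mpoly [tuple match split i with
                    | inl j => alpha (l - j.+1)
                    | inr s => 'X_s
                    end | i < l + N.+1]).

Lemma elim_aC c : elim_a c%:MP = c%:MP.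
Proof. exact: comp_mpolyC. Qed.

Lemma gaudin_actC c v : gaudin_act v c%:MP = c *: v.
Proof. exact: poly_actC. Qed.

Lemma elim_aZ c r : elim_a (c *: r) = c *: elim_a r.
Proof. exact: comp_mpolyZ. Qed.

Lemma gaudin_actZ c q v : gaudin_act v (c *: q) = c *: gaudin_act v q.
Proof. exact: poly_actZ. Qed.

Lemma elim_a_hvar s : elim_a (hvar F l s) = 'X_s.
Proof.
rewrite /elim_a comp_mpolyXU -tnth_nth tnth_mktuple.
by rewrite (unsplitK (inr s : 'I_l + 'I_N.+1)).
Qed.

Lemma elim_a_pxa d : elim_a p`_d = alpha d.
Proof.
have [->|dl] := eqVneq d l; first by rewrite coef_pmonic_lead alpha_l rmorph1.
have [ld|dl'] := ltnP l d; first by rewrite coef_pmonic_high // alpha_gt // raddf0.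
have {dl dl'} dl : (d < l)%N by rewrite ltn_neqAle dl.
have il : (l - d.+1 < l)%N by lia.
have dE : d = (l - (Ordinal il).+1)%N by rewrite /=; lia.
rewrite [in LHS]dE coef_pmonic_low /elim_a comp_mpolyXU -tnth_nth tnth_mktuple.
by rewrite (unsplitK (inl (Ordinal il) : 'I_l + 'I_N.+1)) -dE.
Qed.

Definition top_act u k v q : F := (sep z (gaudin_act v q))@_(set_exp u k l).

Fact top_act_is_scalar u k v : scalar (top_act u k v).
Proof.
move=> c q r; rewrite /top_act (linearP (gaudin_act v)) (linearP (sep z)).
by rewrite mcoeffD mcoeffZ.
Qed.
HB.instance Definition _ u k v :=
  GRing.isLinear.Build F Hr F _ (top_act u k v) (top_act_is_scalar u k v).

Lemma top_actZ u k v c q : top_act u k v (c *: q) = c * top_act u k v q.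
Proof. exact: scalarZ. Qed.

Lemma ode_lhs_sep u k v e :
  ode_lhs z m (fun d => (sep z v)@_(set_exp u k d) : F^o)
    (fun s d => (sep z (gaudin z m s v))@_(set_exp u k d) : F^o) e = 0.
Proof. by rewrite -ode_lhs_mcoeff separation // mulr0 mcoeff0. Qed.

Lemma sum_mcoeff_gaudin w v :
  \sum_s (sep z (gaudin z m s v))@_w = 0.
Proof.
rewrite -(raddf_sum (mcoeff w)) -(raddf_sum (sep z)) sum_gaudin.
by rewrite (raddf0 (sep z)) (raddf0 (mcoeff w)).
Qed.

Lemma sum_z_mcoeff_gaudin w v : Sing v ->
  \sum_s z s * (sep z (gaudin z m s v))@_w = top_weight l m * (sep z v)@_w.
Proof.
case=> _ zv; rewrite -mcoeffZ.
transitivity (sep z (top_weight l m *: v))@_w; last by rewrite linearZ.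
rewrite -zv (raddf_sum (sep z)) raddf_sum; apply: eq_bigr => s _.
by rewrite /= linearZ mcoeffZ.
Qed.

(** A slice of v along y_k obeys the recursion that defines [alpha], started at the coefficient of
    y_k^l instead of 1. The induction runs over all singular vectors at once, because a step for v
    involves the H_s v. *)
Lemma mcoeff_sep_alpha u k d v : Sing v ->
  (sep z v)@_(set_exp u k d) = top_act u k v (alpha d).
Proof.
suff H i : forall d v, Sing v -> (l <= d + i)%N ->
    (sep z v)@_(set_exp u k d) = top_act u k v (alpha d).
  by move=> Sv; apply: (H l); rewrite ?leq_addl.
elim: i => [|i IHi] {}d {}v Sv.
  rewrite addn0 leq_eqVlt => /orP [/eqP <-|ld].
    by rewrite alpha_l /top_act /gaudin_act -mpolyC1 poly_actC scale1r.
  rewrite alpha_gt // (raddf0 (top_act u k v)).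
  by apply: (deg_le_sep (k := k) z charF0 Sv.1); rewrite set_exp_at.
have [ld _|dl ldi] := leqP l d; first by apply: IHi => //; lia.
apply: (mulfI (ode_pivot_neq0 charF0 m_sep dl)).
have pos0 (s : 'I_N.+1) e : (d < e)%N ->
    (sep z (gaudin z m s v))@_(set_exp u k e) = top_act u k v ('X_s * alpha e).
  move=> de; rewrite IHi; [|exact: gaudin_Sing|by lia].
  rewrite mulrC -(gaudin_actX s Sv) /top_act.
  by rewrite -(gaudin_actM (alpha e) 'X_s Sv).
have := ode_lhs_sep u k v (d + N.+1).
rewrite (ode_lhs_pivot (l := l)) => [E1|e|e]; first last.
- exact: sum_z_mcoeff_gaudin.
- exact: sum_mcoeff_gaudin.
have := congr1 (top_act u k v) (alpha_lt dl).
rewrite (raddfD (top_act u k v)) (raddf0 (top_act u k v)) /= top_actZ ode_rest_scalar.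
move=> E2; apply: (addIr (ode_rest z m (fun d => top_act u k v (alpha d) : F^o)
  (fun s e => top_act u k v ('X_s * alpha e) : F^o) d)).
rewrite [RHS]E2 -[RHS]E1; congr (_ + _); apply: eq_bigr => j _.
have dj : (d < d.+1 + j)%N by rewrite ltnS leq_addr.
rewrite (IHi _ _ Sv); last by lia.
by congr (_ + _); apply: eq_bigr => s _; rewrite pos0.
Qed.

Lemma elim_a_ode e : elim_a ('X^2 * Dh z m p)`_e =
  ode_lhs z m alpha (fun s d => 'X_s * alpha d) e.
Proof.
rewrite ode_lhs_Dh (ode_lhs_linear _ _ elim_a); apply: eq_bigr => d _.
rewrite /= elim_a_pxa; congr (_ + _); apply: eq_bigr => s _.
by rewrite /= (rmorphM elim_a) /= elim_a_pxa elim_a_hvar.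
Qed.

(** Acting commutes with acting by [alpha], so every coefficient of the image of v is a coefficient
    at y_k^l of the image of another singular vector w; by [mcoeff_sep_alpha] that is a coefficient
    of the separated equation for w, hence 0. *)
Lemma gaudin_act_ode_sep k e v : Sing v ->
  gaudin_act v (elim_a ('X^2 * Dh z m p)`_e) = 0.
Proof.
set q := elim_a _ => Sv; have Sqv := gaudin_act_Sing q Sv.
apply: (sep_inj z_inj charF0 Sqv.1); apply/mpolyP => u.
rewrite -(set_expK u k) (mcoeff_sep_alpha u k (u k) Sqv) mcoeff0.
have Sav := gaudin_act_Sing (alpha (u k)) Sv.
rewrite /top_act -(gaudin_actM _ _ Sv) mulrC (gaudin_actM _ _ Sv).
rewrite -/(top_act u k (gaudin_act v (alpha (u k))) q) /q elim_a_ode ode_lhs_scalar.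
rewrite -[RHS](ode_lhs_sep u k (gaudin_act v (alpha (u k))) e).
apply: (@eq_ode_lhs F N z m F^o) => [d|s d]; apply: esym; first exact: mcoeff_sep_alpha.
apply: etrans (mcoeff_sep_alpha u k d (gaudin_Sing s Sav)) _.
rewrite /= /top_act -(gaudin_actX s Sav) -(gaudin_actM (alpha d) 'X_s Sav).
by rewrite [alpha d * _]mulrC.
Qed.

Lemma gaudin_act_ode_high d v : Sing v ->
  gaudin_act v (elim_a ('X^2 * Dh z m p)`_(d + N.+1)) = 0.
Proof.
move=> Sv; rewrite elim_a_ode (ode_lhs_linear _ _ (gaudin_act v)).
have bhE s e : gaudin_act v ('X_s * alpha e) = gaudin z m s (gaudin_act v (alpha e)).
  by rewrite (gaudin_actM _ _ Sv) (gaudin_actX s (gaudin_act_Sing (alpha e) Sv)).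
have bh0 e : \sum_s gaudin_act v ('X_s * alpha e) = 0.
  by under eq_bigr do rewrite bhE; exact: sum_gaudin.
have bhz e : \sum_s z s *: gaudin_act v ('X_s * alpha e)
    = top_weight l m *: gaudin_act v (alpha e).
  under eq_bigr do rewrite bhE.
  exact: (gaudin_act_Sing (alpha e) Sv).2.
have [ld|dl] := leqP l d.
  apply: (ode_lhs_high (l := l)) => //= [e le|s e le].
    by rewrite alpha_gt // (raddf0 (gaudin_act v)).
  by rewrite alpha_gt // mulr0 (raddf0 (gaudin_act v)).
rewrite (ode_lhs_pivot (l := l)) //=.
have /(congr1 (gaudin_act v)) := alpha_lt dl.
rewrite (raddfD (gaudin_act v)) (raddf0 (gaudin_act v)) => <-.
rewrite /= linearZ; congr (_ + _); rewrite (raddf_sum (gaudin_act v)).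
apply: eq_bigr => i _.
rewrite /= (raddfD (gaudin_act v)) (raddf_sum (gaudin_act v)) /= linearZ.
by congr (_ + _); apply: eq_bigr => s _; rewrite /= linearZ.
Qed.

Lemma gaudin_act_ode e v : Sing v ->
  gaudin_act v (elim_a ('X^2 * Dh z m p)`_e) = 0.
Proof.
move=> Sv; have [eN|Ne] := ltnP e N.+1; last first.
  by rewrite -(subnK Ne); exact: gaudin_act_ode_high.
have [->|e_gt0] := posnP e.
  by rewrite coefXnM /= (raddf0 elim_a) (raddf0 (gaudin_act v)).
(* The range 0 < e <= N forces N > 0, so a separated coordinate exists. *)
by apply: gaudin_act_ode_sep => //; exact: (Ordinal (leq_trans e_gt0 eN)).
Qed.

Lemma gaudin_act_gen x v : Sing v -> x \in ID_gens l z m ->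
  gaudin_act v (elim_a x) = 0.
Proof.
move=> Sv; rewrite !inE => /or3P [/eqP ->|/eqP ->|/mapP [j j_in ->]].
- rewrite /q_m1 (raddf_sum elim_a) (raddf_sum (gaudin_act v)).
  rewrite -[RHS](sum_gaudin z m v); apply: eq_bigr => s _.
  by rewrite /= elim_a_hvar gaudin_actX.
- rewrite /q_0 (raddfB elim_a) (raddfB (gaudin_act v)).
  apply/eqP; rewrite subr_eq0; apply/eqP.
  rewrite /= elim_aC gaudin_actC.
  rewrite -[RHS]Sv.2 (raddf_sum elim_a) (raddf_sum (gaudin_act v)).
  apply: eq_bigr => s _; rewrite /= elim_aZ gaudin_actZ.
  by rewrite elim_a_hvar gaudin_actX.
move: j_in; rewrite mem_iota => /andP [j_gt0 j_lt].
have -> : q_ l z m j = ('X^2 * Dh z m p)`_(l + N.+1 - j).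
  rewrite coefXnM ltnNge (_ : 2 <= l + N.+1 - j)%N ?/q_; last by lia.
  by congr (_`_ _); lia.
exact: gaudin_act_ode.
Qed.

Lemma gaudin_act_ID r v : Sing v -> ID z m r -> gaudin_act v (elim_a r) = 0.
Proof.
move=> Sv /asboolP [c ->].
rewrite (raddf_sum elim_a) (raddf_sum (gaudin_act v)) big1 // => i _.
(* The factors are reordered so that the generator acts last, on the singular vector produced by its
   cofactor. *)
rewrite /= (rmorphM elim_a) (gaudin_actM _ _ Sv) -(gaudin_actM _ _ Sv) mulrC.
rewrite (gaudin_actM _ _ Sv); apply: gaudin_act_gen.
  exact: gaudin_act_Sing.
exact: mem_nth.
Qed.

Definition top_exp : 'X_{1..N} := [multinom l | _ < N].

(* The inverse of tau: as p is monic, the coefficient of \prod_k y_k^l in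
   \prod_k p(y_k) is 1. *)
Definition dual_functional v (r : R) : F :=
  (sep z (gaudin_act v (elim_a r)))@_top_exp.

Fact dual_functional_is_scalar v : scalar (dual_functional v).
Proof.
move=> c a b; rewrite /dual_functional (linearP elim_a) (linearP (gaudin_act v)).
by rewrite (linearP (sep z)) mcoeffD mcoeffZ.
Qed.
HB.instance Definition _ v :=
  GRing.isLinear.Build F R F _ (dual_functional v) (dual_functional_is_scalar v).

Lemma kills_ID_dual v : Sing v -> kills_ID z m (dual_functional v).
Proof.
move=> Sv r Ir; rewrite /= /dual_functional (gaudin_act_ID Sv Ir) (raddf0 (sep z)).
by rewrite mcoeff0.
Qed.

(** One variable at a time, [mcoeff_sep_alpha] raises the exponent u k to l at the cost of acting by
    [alpha (u k)]; [r] lists the variables already treated. *)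
Lemma mcoeff_sep_dual u v : Sing v ->
  (sep z v)@_u = dual_functional v (\prod_k p`_(u k)).
Proof.
move=> Sv.
suff H (r : seq 'I_N) : uniq r -> (sep z v)@_u =
    (sep z (gaudin_act v (\prod_(k <- r) alpha (u k))))
      @_[multinom (if k \in r then l else u k) | k < N].
  rewrite (H (enum 'I_N) (enum_uniq _)) /dual_functional.
  have -> : elim_a (\prod_k p`_(u k)) = \prod_(k <- enum 'I_N) alpha (u k).
    rewrite (rmorph_prod elim_a) big_enum; apply: eq_big => // k _.
    by rewrite /= elim_a_pxa.
  have -> : [multinom (if k \in enum 'I_N then l else u k) | k < N] = top_exp.
    by apply/mnmP => k; rewrite !mnmE mem_enum.
  by [].
elim: r => [_|k r IHr /= /andP [kr r_uniq]].
  rewrite big_nil /gaudin_act -mpolyC1 poly_actC scale1r; congr (_@__).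
  by apply/mnmP => k; rewrite mnmE.
rewrite (IHr r_uniq) big_cons (gaudin_actM _ _ Sv).
set w := gaudin_act v _; set u' := [multinom _ | k < N].
have Sw : Sing w by exact: gaudin_act_Sing.
rewrite -(set_expK u' k) (mcoeff_sep_alpha u' k (u' k) Sw) /top_act.
rewrite mnmE (negPf kr); congr (_@__).
apply/mnmP => j; rewrite !mnmE inE.
by case: eqP.
Qed.

Lemma tau_lift_dual v : Sing v -> tau_lift z (dual_functional v) = v.
Proof.
move=> Sv; apply/eqP; rewrite -subr_eq0; apply/eqP.
apply: (sep_inj z_inj charF0 (d := l)).
  by apply: hom_degB Sv.1; exact: hom_tau_lift.
rewrite (raddfB (sep z)); apply/mpolyP => u.
by rewrite mcoeffB mcoeff_sep_tau_lift // mcoeff_sep_dual // subrr mcoeff0.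
Qed.

End Surjectivity.

(** * Passage from F[a, h] to A_D, and conclusion *)

Section Descent.
Variables (F : fieldType) (n l : nat) (z m : 'I_n -> F).
Local Notation R := {mpoly F[l + n]}.

Lemma scalar_AD_lift (G : {scalar R}) : kills_ID z m G ->
  exists g : {scalar AD l z m}, forall r, G r = g (piAD z m r).
Proof.
move=> GI; pose rp (x : AD l z m) : R := repr (x : {ideal_quot ID_closed l z m}).
have GE r s : piAD z m r = piAD z m s -> G r = G s.
  by move=> /piAD_eq /GI; rewrite raddfB => /eqP; rewrite subr_eq0 => /eqP.
have g_scalar : scalar (fun x : AD l z m => G (rp x)).
  move=> c x y; rewrite -[RHS](linearP G); apply: GE.
  by rewrite (piAD_linear z m) !piAD_repr.
pose gM := GRing.isLinear.Build F (AD l z m) F _ (fun x => G (rp x)) g_scalar.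
pose g : {scalar AD l z m} := HB.pack (fun x => G (rp x)) gM.
by exists g => r; apply: GE; rewrite piAD_repr.
Qed.

Lemma scalar_AD_pullback (g : {scalar AD l z m}) :
  exists2 G : {scalar R}, kills_ID z m G & forall r, G r = g (piAD z m r).
Proof.
have G_scalar : scalar (fun r => g (piAD z m r)).
  by move=> c r s; rewrite (piAD_linear z m) linearP.
pose GM := GRing.isLinear.Build F R F _ (fun r => g (piAD z m r)) G_scalar.
pose G : {scalar R} := HB.pack (fun r => g (piAD z m r)) GM.
exists G => // r Ir /=; rewrite -/(piAD_lin z m r) piAD_eq0 //.
exact: raddf0.
Qed.

End Descent.

Lemma tau_iso_pos (F : fieldType) (N l : nat) (z m : 'I_N.+1 -> F) :
  [pchar F] =i pred0 -> injective z -> separating m l ->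
  (forall v : {mpoly F[N.+1]},
     is_sing m l v <-> exists g : {scalar AD l z m}, tau g = v) /\
  (forall g : {scalar AD l z m}, tau g = 0 -> forall f, g f = 0).
Proof.
move=> charF0 z_inj m_sep; split=> [v|g g0 f].
  rewrite (is_sing_gaudin _ _ z_inj); split=> [Sv|[g <-]].
    have [g gE] := scalar_AD_lift (kills_ID_dual z_inj charF0 m_sep Sv).
    by exists g; rewrite (tau_liftE gE) tau_lift_dual.
  have [G GI GE] := scalar_AD_pullback g.
  by rewrite (tau_liftE GE); exact: in_sing_tau_lift.
have [G GI GE] := scalar_AD_pullback g.
rewrite (tau_liftE GE) in g0.
by rewrite -[f]piAD_repr -GE (tau_lift_inj z_inj charF0 m_sep GI g0).
Qed.

(** For l > 0 the generator q_0 is a nonzero constant, so A_D and the singular subspace are both 0;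
    for l = 0 both are one-dimensional. *)
Lemma tau_iso0 (F : fieldType) (l : nat) (z m : 'I_0 -> F) :
  [pchar F] =i pred0 -> separating m l ->
  (forall v : {mpoly F[0]},
     is_sing m l v <-> exists g : {scalar AD l z m}, tau g = v) /\
  (forall g : {scalar AD l z m}, tau g = 0 -> forall f, g f = 0).
Proof.
move=> charF0 m_sep.
have mnm0 (k : 'X_{1..0}) : k = 0%MM by apply/mnmP => -[].
have singE v : is_sing m l v <-> l%:R *: v = 0.
  by rewrite /is_sing /gl2_act !big_ord0; split=> [[_ <-]|->].
have natf0 := (pcharf0P F).1 charF0.
have [l0|l_gt0] := posnP l; last first.
  have ID1 : ID z m (1 : {mpoly F[l + 0]}).
    have c0 : l%:R * (1 - l%:R) != 0 :> F.
      rewrite mulf_neq0 ?natf0 -?lt0n // subr_eq0 eq_sym -subr_eq0.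
      rewrite -(natrB _ l_gt0) natf0 subn_eq0 -ltnNge ltn_neqAle l_gt0 andbT.
      (* The value l = 1, at which q_0 would vanish, is not separating: for i = 1 the quantity is 0
         - 2 + 1 + 1 = 0. *)
      apply/eqP => l1; have := m_sep 1%N; rewrite -l1 => /(_ isT) /eqP.
      by rewrite big_ord0; apply; ring.
    have -> : 1 = (- (l%:R * (1 - l%:R))^-1)%:MP * q_0 l z m.
      rewrite /q_0 !big_ord0 !add0r -mpolyCN -mpolyCM mulrNN mulVf ?mpolyC1 //.
    exact/ID_mull/ID_q_0.
  have AD0 (f : AD l z m) : f = 0.
    rewrite -[f]piAD_repr -/(piAD_lin z m _) piAD_eq0 //.
    by rewrite -[repr _]mulr1; exact: ID_mull.
  split=> [v|g _ f]; last by rewrite (AD0 f) raddf0.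
  rewrite singE; split=> [/eqP|[g <-]].
    rewrite scaler_eq0 natf0 eqn0Ngt l_gt0 => /eqP ->.
    have [G GI GE] := scalar_AD_pullback (\0 : {scalar AD l z m}).
    exists \0; rewrite (tau_liftE GE); apply/mpolyP => k.
    by rewrite mcoeff_tau_lift GE mcoeff0.
  apply/mpolyP => k; have [G GI GE] := scalar_AD_pullback g.
  rewrite (tau_liftE GE) mcoeffZ mcoeff_tau_lift GE [piAD _ _ _]AD0.
  by rewrite raddf0 mulr0 mcoeff0.
subst l.
have omega1 : (omega_a 0 z)@_0 = 1.
  apply/eqP; rewrite -subr_eq0; apply/eqP/a_of_t_inj.
  by rewrite comp_mpolyB omega_aP /omega_t big_ord0 mcoeff1 eqxx comp_mpoly1 subrr.
have ID0 (r : {mpoly F[0 + 0]}) : ID z m r -> r = 0.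
  move=> /asboolP [c ->]; rewrite big1 // => i _.
  suff /eqP -> : (ID_gens 0 z m)`_i == 0 by rewrite mulr0.
  have : (ID_gens 0 z m)`_i \in ID_gens 0 z m by exact: mem_nth.
  rewrite /ID_gens /= !inE /q_m1 /q_0 !big_ord0 mul0r mpolyC0 subr0.
  by rewrite orbb.
have tauE (g : {scalar AD 0 z m}) k : (tau g)@_k = g (piAD z m 1).
  have [G GI GE] := scalar_AD_pullback g.
  by rewrite (tau_liftE GE) mcoeff_tau_lift GE (mnm0 k) omega1 /a_to_Fah comp_mpoly1.
have mpoly0C (f : {mpoly F[0 + 0]}) : f = f@_0 *: 1.
  by apply/mpolyP => k; rewrite (mnm0 k) mcoeffZ mcoeff1 eqxx mulr1.
split=> [v|g g0 f]; last first.
  have := tauE g 0%MM; rewrite g0 mcoeff0 -[f]piAD_repr => g1.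
  rewrite (mpoly0C (repr _)) -scaleAD_pi.
  by apply: etrans (scalarZ g _ (piAD z m 1)) _; rewrite -g1 mulr0.
rewrite singE; split=> [_|_]; last by rewrite scale0r.
have G_scalar : scalar (fun r : {mpoly F[0 + 0]} => v@_0 * r@_0).
  by move=> c r s; rewrite mcoeffD mcoeffZ; ring.
pose GM := GRing.isLinear.Build F {mpoly F[0 + 0]} F _ _ G_scalar.
pose G : {scalar {mpoly F[0 + 0]}} :=
  HB.pack (fun r : {mpoly F[0 + 0]} => v@_0 * r@_0) GM.
have [|g gE] := @scalar_AD_lift F 0 0 z m G.
  by move=> r /ID0 ->; rewrite raddf0.
exists g; apply/mpolyP => k; rewrite tauE -gE (mnm0 k) /=.
by rewrite mcoeff1 eqxx mulr1.
Qed.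

Theorem theorem4p3p1 (R : realType) (n l : nat) (z m : 'I_n -> R[i])
    (z_distinct : injective z) (m_l_separating : separating m l) :
  (forall v : {mpoly R[i][n]},
     is_sing m l v <-> exists g : {scalar AD l z m}, tau g = v) /\
  (forall g : {scalar AD l z m}, tau g = 0 -> forall f, g f = 0).
Proof.
have charC := @Num.Theory.pchar_num R[i].
case: n => [|n] in z m z_distinct m_l_separating *.
  exact: tau_iso0.
exact: tau_iso_pos.
Qed.
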